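(* Let $G$ be a countable infinite discrete Abelian group and let $T=(T_g)_{g\in G}$ be the $(C,F)$-action of $G$ associated with a sequence $(C_n,F_{n-1})_{n\ge1}$ satisfying (I)–(III) and (D). Let $\mu$ be the $(C,F)$-measure with $\mu([0]_0)=1$. Suppose that for each $g\in G$, $$(g+F_n+F_n-F_n-F_n)\cap(C_{n+1}-C_{n+1})=\{0\}\quad\text{for all sufficiently large }n.$$ Then $$\lim_{n\to\infty}\frac{\sum_{g\in F_n-F_n}\mu(A\cap T_gB)}{\sum_{g\in F_n-F_n}\mu([0]_0\cap T_g[0]_0)}=\mu(A)\mu(B)$$ for all Borel subsets $A,B\subset[0]_0$. Thus $T$ is weakly rationally ergodic along $(F_n-F_n)_{n\ge0}$.
   Context: **$(C,F)$-construction (Abelian group $G$, additive notation).** Let $(F_n)_{n\ge0}$, $(C_n)_{n\ge1}$ be finite subsets of $G$ with: (I) $F_0=\{0\}$, $\#C_n>1$; (II) $F_n+C_{n+1}\subset F_{n+1}$; (III) $(F_n+c)\cap(F_n+c')=\emptyset$ for distinct $c,c'\in C_{n+1}$. Put $X_n=F_n\times C_{n+1}\times C_{n+2}\times\cdots$ (product topology), embed $X_n$ into $X_{n+1}$ by $(f_n,c_{n+1},c_{n+2},\dots)\mapsto(f_n+c_{n+1},c_{n+2},\dots)$, and let $X=\bigcup_nX_n$ be the topological inductive limit. For $A\subset F_n$ let $[A]_n=\{(f_n,c_{n+1},\dots)\in X_n: f_n\in A\}$; $[f]_n=[\{f\}]_n$. The $(C,F)$-measure is the Radon measure on $X$ with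 $\mu([A]_n)=\#A/(\#C_1\cdots\#C_n)$. The $(C,F)$-action is: $T_gx=(g+f_n,c_{n+1},\dots)$ whenever $x=(f_n,c_{n+1},\dots)\in X_n$ and $g+f_n\in F_n$; it is defined on the set of those $x\in X$ for which, for every $g\in G$, such an $n$ exists. This set is $\mu$-conull if and only if (D) for each $g\in G$ and $n>0$, $\displaystyle\lim_{m\to\infty}\frac{\#\big((g+F_n+C_{n+1}+\cdots+C_m)\cap F_m\big)}{\#F_n\,\#C_{n+1}\cdots\#C_m}=1$, and in that case $T$ is a $\mu$-preserving, conservative, ergodic action. $A\pm B=\{a\pm b:a\in A,b\in B\}$. **Weak rational ergodicity.** Let $T$ be an ergodic conservative measure preserving action of an amenable group $G$ on a $\sigma$-finite measure space $(X,\mathfrak B,\mu)$ and let $(E_n)_{n\ge0}$ be an increasing Følner sequence in $G$. $T$ is called weakly rationally ergodic along $(E_n)_{n\ge0}$ if there is a subset $Y$ of finite positive measure such that $\lim_{n\to\infty}\frac1{a_n(Y)}\sum_{g\in E_n}\mu(A\cap T_gB)=\mu(A)\mu(B)$ for all measurable $A,B\subset Y$, where $a_n(Y)=\sum_{g\in E_n}\mu(Y\cap T_gY)/\mu(Y)^2$.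
   Formalization: Weak rational ergodicity is stated here for increasing sequences of finite sets without the Følner requirement of its definition, because F_n − F_n need not be a Følner sequence under the stated hypotheses; everything else is as in the statement. *)

(* Defs.v *)
From HB Require Import structures.
From mathcomp Require Import all_boot all_order all_algebra.
From mathcomp Require Import finmap generic_quotient.
From mathcomp Require Import all_classical all_reals all_analysis.

Set Implicit Arguments.
Unset Strict Implicit.
Unset Printing Implicit Defensive.

Import Order.TTheory GRing.Theory Num.Theory.
Import numFieldNormedType.Exports.

Local Open Scope classical_set_scope.
Local Open Scope ring_scope.
Local Open Scope quotient_scope.

Definition fset_add (G : zmodType) (A B : {fset G}) : {fset G} :=
  [fset (a + b)%R | a in A, b in B]%fset.

Definition fset_sub (G : zmodType) (A B : {fset G}) : {fset G} :=
  [fset (a - b)%R | a in A, b in B]%fset.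

Notation "A :+: B" := (fset_add A B)
  (at level 50, left associativity) : fset_scope.
Notation "A :-: B" := (fset_sub A B)
  (at level 50, left associativity) : fset_scope.

(* C is used only at positive indices; its value at 0 is irrelevant. *)
Record CF_sequence (G : zmodType) := CFSequence {
  CF_F : nat -> {fset G};
  CF_C : nat -> {fset G};
  CF_F0 : CF_F 0 = [fset 0]%fset;
  CF_C_gt1 : forall n, (1 < #|` CF_C n.+1|)%N;
  CF_sub : forall n, (CF_F n :+: CF_C n.+1 `<=` CF_F n.+1)%fset;
  CF_disj : forall n c c', c \in CF_C n.+1 -> c' \in CF_C n.+1 -> c <> c' ->
    ((CF_F n :+: [fset c]) `&` (CF_F n :+: [fset c']) = fset0)%fset
}.

(* The action (defined below) is defined almost everywhere iff this holds. *)
Definition CF_full (R : realType) (G : zmodType) (S : CF_sequence G) : Prop :=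
  forall (g : G) (n : nat), (0 < n)%N ->
    (fun m =>
       let Cs := \big[@fset_add G/[fset 0]%fset]_(n.+1 <= k < m.+1) CF_C S k in
       (#|` (([fset g] :+: CF_F S n :+: Cs) `&` CF_F S m)%fset|)%:R /
       (#|` CF_F S n| * \prod_(n.+1 <= k < m.+1) #|` CF_C S k|)%N%:R : R)
    @ \oo --> (1 : R).

Section space.
Context (G : zmodType) (S : CF_sequence G).
Local Notation F := (CF_F S).
Local Notation C := (CF_C S).

(* The point (f_n, c_(n+1), c_(n+2), ...) of X_n is encoded as a pair (f, c)
   with f = f_n and c k = c_(n+1+k). *)
Definition CF_seqs : Type :=
  (discrete_topology G * {ptws nat -> discrete_topology G})%type.

Definition CF_level_set (n : nat) : set CF_seqs :=
  [set x | x.1 \in F n /\ forall k, x.2 k \in C (n + k).+1].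

Definition CF_level (n : nat) : topologicalType := set_type (CF_level_set n).

Definition CF_head n (x : CF_level n) : G := (set_val x).1.
Definition CF_tail n (x : CF_level n) (k : nat) : G := (set_val x).2 k.

Definition CF_embed_val n (x : CF_level n) : CF_seqs :=
  (CF_head x + CF_tail x 0, fun k => CF_tail x k.+1).

Lemma CF_embed_subproof n (x : CF_level n) :
  CF_embed_val x \in CF_level_set n.+1.
Proof.
case: x => x xP; move/set_mem: (xP) => [x1 x2].
apply/mem_set; split => [|k] /=.
  apply: (fsubsetP (CF_sub S n)); apply/imfset2P; exists x.1 => //.
  exists (x.2 0) => //; first by move: (x2 0%N); rewrite addn0.
by move: (x2 k.+1); rewrite addnS addSn.
Qed.

Definition CF_embed n (x : CF_level n) : CF_level n.+1 :=
  exist _ (CF_embed_val x) (CF_embed_subproof x).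

Definition CF_sum : Type := {n : nat & CF_level n}.

Definition CF_step (p : CF_sum) : CF_sum :=
  existT _ (tag p).+1 (CF_embed (tagged p)).

(* X is the disjoint union of the X_n modulo "some iterated images under the
   embeddings coincide"; the quotient topology is the inductive limit one. *)
Definition CF_eqv (p q : CF_sum) : bool :=
  `[< exists i j, iter i CF_step p = iter j CF_step q >].

Lemma CF_eqv_refl : reflexive CF_eqv.
Proof. by move=> p; apply/asboolP; exists 0%N, 0%N. Qed.

Lemma CF_eqv_sym : symmetric CF_eqv.
Proof.
by move=> p q; apply/asboolP/asboolP => -[i [j e]]; exists j, i; rewrite e.
Qed.

Lemma CF_eqv_trans : transitive CF_eqv.
Proof.
move=> q p r /asboolP[i [j e]] /asboolP[k [l e']]; apply/asboolP.
exists (k + i)%N, (j + l)%N.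
by rewrite iterD e -iterD addnC iterD e' -iterD.
Qed.

Canonical CF_equiv := EquivRel CF_eqv CF_eqv_refl CF_eqv_sym CF_eqv_trans.

Definition CF_space : Type := quotient_topology {eq_quot CF_equiv}.

HB.instance Definition _ := Topological.on CF_space.

Definition CF_pt n (x : CF_level n) : CF_space :=
  \pi_({eq_quot CF_equiv}) (existT _ n x : CF_sum).

Lemma CF_base_subproof :
  ((0, fun k => nth 0 (enum_fset (C k.+1)) 0) : CF_seqs) \in CF_level_set 0.
Proof.
apply/mem_set; split => [|k] /=; first by rewrite CF_F0 inE.
by rewrite add0n; apply: mem_nth; exact: ltnW (CF_C_gt1 S k).
Qed.

HB.instance Definition _ := isPointed.Build CF_space
  (CF_pt (exist (fun x => x \in CF_level_set 0) _ CF_base_subproof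
     : CF_level 0)).

Definition CF_borel := g_sigma_algebraType (@open CF_space).

Definition CF_cylinder (n : nat) (A : {fset G}) : set CF_borel :=
  [set CF_pt x | x in [set x : CF_level n | CF_head x \in A]].

(* The cylinders are compact open, generate the Borel sets, and X is a countable
   union of them: a Borel measure with these values is unique and Radon. *)
Definition is_CF_measure (R : realType)
    (mu : {measure set CF_borel -> \bar R}) : Prop :=
  forall n (A : {fset G}), (A `<=` F n)%fset ->
    mu (CF_cylinder n A) =
      ((#|` A|)%:R / (\prod_(1 <= k < n.+1) #|` C k|)%N%:R)%:E.

Definition CF_dom : set CF_borel :=
  [set x | forall g, exists n (y : CF_level n),
    x = CF_pt y /\ g + CF_head y \in F n].

(* The action, extended by the identity off its (conull) domain. *)
Definition CF_action (g : G) (x : CF_borel) : CF_borel :=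
  xget x [set x' | CF_dom x /\ exists n (y y' : CF_level n),
    [/\ x = CF_pt y, x' = CF_pt y', CF_head y' = g + CF_head y &
        CF_tail y' = CF_tail y]].

End space.

Arguments CF_cylinder {G} S n A _.
Arguments CF_dom {G} S _.
Arguments CF_action {G} S g x.

Section action.
Context (G : zmodType) (d : measure_display) (X : measurableType d).
Context (R : realType) (T : G -> X -> X) (mu : {measure set X -> \bar R}).

Definition measure_preserving_action : Prop :=
  [/\ forall x, T 0 x = x,
      forall g h x, T (g + h) x = T g (T h x),
      forall g, measurable_fun setT (T g) &
      forall g A, measurable A -> mu (T g @^-1` A) = mu A].

Definition conservative_action : Prop :=
  forall A, measurable A -> (0 < mu A)%E ->
    exists g, g <> 0 /\ (0 < mu (A `&` T g @` A))%E.

Definition ergodic_action : Prop :=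
  forall A, measurable A -> (forall g, mu (A `+` T g @` A) = 0%E) ->
    mu A = 0%E \/ mu (~` A) = 0%E.

(* Sum over g in E of mu (A `&` T_g B), meant for A and B of finite measure. *)
Definition return_sum (E : {fset G}) (A B : set X) : R :=
  \sum_(g <- enum_fset E) fine (mu (A `&` T g @` B)).

(* No Folner condition is put on E: the property does not mention it, and in the
   (C,F)-setting the sets F_n - F_n need not form a Folner sequence (F_n may
   contain many sparse points outside F_(n-1) + C_n). *)
Definition weakly_rationally_ergodic (E : nat -> {fset G}) : Prop :=
  [/\ sigma_finite setT mu,
      measure_preserving_action /\ conservative_action,
      ergodic_action,
      forall n, (E n `<=` E n.+1)%fset &
      exists Y, [/\ measurable Y, (0 < mu Y)%E, (mu Y < +oo)%E &
        let a n := return_sum (E n) Y Y / fine (mu Y) ^+ 2 in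
        forall A B, measurable A -> measurable B -> A `<=` Y -> B `<=` Y ->
          (fun n => (a n)^-1 * return_sum (E n) A B) @ \oo
            --> fine (mu A) * fine (mu B)]].

End action.

(* Main.v *)
(* For n large, sparseness at g = 0 shows that if x and T_(-g) x both lie in
   [0]_0 with g in F_n - F_n, then their coordinates agree beyond level n; hence,
   writing Q_n = C_1 + ... + C_n, so that [0]_0 is the disjoint union of the
   [q]_n with q in Q_n, a given A in [q]_n meets T_g [q']_n (up to a null set)
   only for g = q - q', and then A is contained in T_g [q']_n. Summing over q
   gives, for A in [0]_0 and B a union of cylinders [q']_n in [0]_0, the exact
   value #Q_n mu(A) mu(B) for the sum of mu(A \cap T_g B) over F_n - F_n, and
   in particular #Q_n for A = B = [0]_0. For fixed A the normalized sum is
   additive in B and, by symmetry in A and B, dominated by mu(B), so that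
   Dynkin's lemma extends the limit to all Borel B. Conservativity and
   ergodicity then follow from the limit after translating into [0]_0: a
   wandering set would give sums bounded by mu(A) while #Q_n tends to infinity,
   and an invariant set and its complement would give vanishing sums. *)
Require Import Defs.
From HB Require Import structures.
From mathcomp Require Import all_boot all_order all_algebra.
From mathcomp Require Import finmap generic_quotient.
From mathcomp Require Import ring zify.
From mathcomp Require Import all_classical all_reals all_analysis.

Set Implicit Arguments.
Unset Strict Implicit.
Unset Printing Implicit Defensive.

Import Order.TTheory GRing.Theory Num.Theory.
Import numFieldNormedType.Exports.

Local Open Scope classical_set_scope.
Local Open Scope ring_scope.
Local Open Scope quotient_scope.

(** * Sumsets and difference sets *)

Section fset_add_theory.
Context (G : zmodType).
Implicit Types A B D : {fset G}.

Lemma fset_addP A B x :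
  reflect (exists a b, [/\ a \in A, b \in B & x = a + b]) (x \in (A :+: B)%fset).
Proof.
apply: (iffP idP).
  by move=> /imfset2P[a aA [b bB ->]]; exists a, b.
by move=> [a [b [aA bB ->]]]; apply/imfset2P; exists a => //; exists b.
Qed.

Lemma fset_subP A B x :
  reflect (exists a b, [/\ a \in A, b \in B & x = a - b]) (x \in (A :-: B)%fset).
Proof.
apply: (iffP idP).
  by move=> /imfset2P[a aA [b bB ->]]; exists a, b.
by move=> [a [b [aA bB ->]]]; apply/imfset2P; exists a => //; exists b.
Qed.

Lemma fset_add0 A : (A :+: [fset 0] = A)%fset.
Proof.
apply/fsetP => x; apply/fset_addP/idP => [[a [b [aA]]]|xA].
  by rewrite inE => /eqP -> ->; rewrite addr0.
by exists x, 0; rewrite inE eqxx addr0.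
Qed.

Lemma fset_addA A B D : (A :+: (B :+: D) = A :+: B :+: D)%fset.
Proof.
apply/fsetP => x; apply/fset_addP/fset_addP.
  move=> [a [_ [aA /fset_addP[b [c [bB cD ->]]] ->]]].
  exists (a + b), c; split => //; last by rewrite addrA.
  by apply/fset_addP; exists a, b.
move=> [_ [c [/fset_addP[a [b [aA bB ->]]] cD ->]]].
exists a, (b + c); split => //; last by rewrite addrA.
by apply/fset_addP; exists b, c.
Qed.

Lemma fset_addC A B : (A :+: B = B :+: A)%fset.
Proof.
by apply/fsetP => x; apply/fset_addP/fset_addP => -[a [b [aA bB ->]]]; exists b, a;
  rewrite addrC.
Qed.

Lemma fset_add0l A : ([fset 0] :+: A = A)%fset.
Proof. by rewrite fset_addC fset_add0. Qed.

(** Makes the lemmas on big operators apply to the iterated sumset in [CF_full]. *)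
HB.instance Definition _ := Monoid.isComLaw.Build {fset G} [fset 0]%fset (@fset_add G)
  fset_addA fset_addC fset_add0l.

End fset_add_theory.

(** * Coordinates, cylinders and the Borel sigma-algebra *)

Section coordinates.
Context (G : zmodType) (S : CF_sequence G).
Local Notation F := (CF_F S).
Local Notation C := (CF_C S).
Local Notation X := (CF_borel S).

(** A relation instead of a coordinate map, since a point has coordinates at level [n] only if it
    lies in $X_n$. It hides the quotient and the subtypes from the later proofs. *)
Definition CF_coord n (f : G) (t : nat -> G) (x : X) : Prop :=
  exists y : CF_level S n, [/\ x = CF_pt y, CF_head y = f & CF_tail y = t].

Lemma CF_coord_ex (x : X) : exists n f t, CF_coord n f t x.
Proof.
have [p <-] : exists p, \pi_({eq_quot CF_equiv S}) p = x.
  by exists (repr x); rewrite reprK.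
by case: p => n y; exists n, (CF_head y), (CF_tail y), y.
Qed.

Lemma CF_coord_head n f t x : CF_coord n f t x -> f \in F n.
Proof. by case=> -[y yX] [_ <- _]; case: (set_mem yX). Qed.

Lemma CF_coord_tail n f t x : CF_coord n f t x -> forall k, t k \in C (n + k).+1.
Proof. by case=> -[y yX] [_ _ <-]; case: (set_mem yX). Qed.

Lemma CF_level_eq n (y z : CF_level S n) :
  CF_head y = CF_head z -> CF_tail y = CF_tail z -> y = z.
Proof.
case: y => [[f t] p]; case: z => [[f' t'] p'].
rewrite /CF_head /CF_tail /= => ef et.
move: p p'; rewrite (ef : f = f') (et : t = t') => p p'.
by rewrite (bool_irrelevance p p').
Qed.

Lemma CF_pt_embed n (y : CF_level S n) : CF_pt (CF_embed y) = CF_pt y.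
Proof.
by apply/eqmodP/asboolP; exists 0%N, 1%N.
Qed.

Lemma CF_coordS n f t x :
  CF_coord n f t x -> CF_coord n.+1 (f + t 0%N) (fun k => t k.+1) x.
Proof.
move=> [y [-> <- <-]]; exists (CF_embed y); split => //.
by rewrite CF_pt_embed.
Qed.

(** By (III) the new head [f + c] determines [c], hence also [f]. *)
Lemma CF_embed_inj n : injective (@CF_embed G S n).
Proof.
move=> y z /(congr1 (@set_val _ _)) /= [e0 et].
have tk k : CF_tail y k.+1 = CF_tail z k.+1 by rewrite (congr1 (@^~ k) et).
have hd (w : CF_level S n) : CF_head w \in F n /\ CF_tail w 0 \in C n.+1.
  have h : CF_coord n (CF_head w) (CF_tail w) (CF_pt w) by exists w.
  split; first exact: CF_coord_head h.
  by have := CF_coord_tail h 0; rewrite addn0.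
have [[yF yC] [zF zC]] := (hd y, hd z).
have e1 : CF_tail y 0 = CF_tail z 0.
  apply: contrapT => ne; have := CF_disj yC zC ne => /fsetP.
  move=> /(_ (CF_head y + CF_tail y 0)); rewrite in_fset0 => /negbT /negP; apply.
  rewrite in_fsetI; apply/andP; split; apply/fset_addP.
    by exists (CF_head y), (CF_tail y 0); rewrite inE.
  by exists (CF_head z), (CF_tail z 0); rewrite inE.
apply: CF_level_eq; last by apply/funext => -[|k].
by move: e0; rewrite e1 => /addIr.
Qed.

Lemma iter_CF_step i (p : CF_sum S) : tag (iter i (@CF_step G S) p) = (tag p + i)%N.
Proof. by elim: i => [|i IH] /=; rewrite ?addn0// IH addnS. Qed.

Lemma CF_step_inj (p q : CF_sum S) : CF_step p = CF_step q -> p = q.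
Proof.
case: p => n y; case: q => m z; rewrite /CF_step /= => e.
have nm : n = m by have := congr1 (@tag _ _) e => /= -[].
subst m; congr existT; apply: CF_embed_inj.
by move: e => /eqP; rewrite eq_Tagged /= => /eqP.
Qed.

(** Equivalent points of one level become equal after equally many steps, as each step raises the
    level by one, and steps are injective. *)
Lemma CF_coord_inj n f t f' t' x :
  CF_coord n f t x -> CF_coord n f' t' x -> f = f' /\ t = t'.
Proof.
move=> [y [-> <- <-]] [z [+ <- <-]].
move=> /eqmodP/asboolP[i [j e]].
have ij : i = j.
  by have := congr1 (@tag _ _) e; rewrite !iter_CF_step /= => /addnI.
subst j.
have -> : y = z.
  have : existT _ n y = existT _ n z :> CF_sum S.
    by elim: i e => [//|i IH] /= /CF_step_inj.
  by move=> /eqP; rewrite eq_Tagged /= => /eqP.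
by [].
Qed.

Lemma CF_coord_fun n f t x x' : CF_coord n f t x -> CF_coord n f t x' -> x = x'.
Proof.
move=> [y [-> hy ty]] [z [-> hz tz]]; congr CF_pt.
by apply: CF_level_eq; rewrite ?hy ?ty.
Qed.

Lemma CF_coord_mk n f t :
  f \in F n -> (forall k, t k \in C (n + k).+1) -> exists x, CF_coord n f t x.
Proof.
move=> fF tC; have p : ((f, t) : CF_seqs G) \in CF_level_set S n by apply/mem_set.
by exists (CF_pt (exist _ (f, t) p : CF_level S n)), (exist _ (f, t) p).
Qed.

Lemma CF_coord_unstep n f c t x : f \in F n -> c \in C n.+1 ->
  CF_coord n.+1 (f + c) t x -> CF_coord n f (fun k => if k is k'.+1 then t k' else c) x.
Proof.
move=> fF cC h.
have [|x' h'] := @CF_coord_mk n f (fun k => if k is k'.+1 then t k' else c) fF.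
  move=> [|k]; first by rewrite addn0.
  by have := CF_coord_tail h k; rewrite addnS addSn.
suff -> : x = x' by [].
exact: (CF_coord_fun h (CF_coordS h')).
Qed.

End coordinates.

Section cylinders.
Context (G : zmodType) (S : CF_sequence G).
Local Notation F := (CF_F S).
Local Notation C := (CF_C S).
Local Notation X := (CF_borel S).
Local Notation cyl := (CF_cylinder S).

Lemma CF_coord_raise k n f t (x : X) : CF_coord n f t x ->
  CF_coord (n + k) (f + \sum_(i < k) t i) (fun i => t (k + i)%N) x.
Proof.
move=> h; elim: k => [|k IH]; first by rewrite addn0 big_ord0 addr0.
rewrite addnS big_ord_recr addrA /=.
have := CF_coordS IH; rewrite addn0.
by under [X in CF_coord _ _ X _ -> _]funext do rewrite addnS.
Qed.

(* [CF_desc A n k] is [A + C_(n+1) + ... + C_(n+k)]. *)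
Fixpoint CF_desc (A : {fset G}) (n k : nat) : {fset G} :=
  if k is k'.+1 then (CF_desc A n k' :+: C (n + k').+1)%fset else A.

Lemma CF_desc_sub A n k : (A `<=` F n)%fset -> (CF_desc A n k `<=` F (n + k))%fset.
Proof.
move=> AF; elim: k => [|k IH]; first by rewrite addn0.
rewrite addnS /=; apply/fsubsetP => x /fset_addP[a [b [aA bC ->]]].
apply: (fsubsetP (CF_sub S (n + k))); apply/fset_addP; exists a, b; split => //.
exact: (fsubsetP IH).
Qed.

Lemma CF_cylinderP n A (x : X) :
  cyl n A x <-> exists f t, f \in A /\ CF_coord n f t x.
Proof.
split.
  move=> [y yA <-]; exists (CF_head y), (CF_tail y); split; first exact: yA.
  by exists y.
by move=> [f [t [fA [y [-> yf _]]]]]; exists y => //; rewrite /= yf.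
Qed.

Lemma CF_cylinder1 n f t (x : X) : CF_coord n f t x -> cyl n [fset f]%fset x.
Proof. by move=> h; apply/CF_cylinderP; exists f, t; rewrite inE. Qed.

Lemma CF_coord_cyl n f t A (x : X) : CF_coord n f t x -> cyl n A x <-> f \in A.
Proof.
move=> h; split=> [/CF_cylinderP[f' [t' [f'A]]]|fA].
  by move=> /(CF_coord_inj h)[-> _].
by apply/CF_cylinderP; exists f, t.
Qed.

(** The inclusion of [A] in [F n] lets a head [a + c] of level [n.+1] descend to the head [a] of
    level [n]. *)
Lemma CF_cylinderS n A : (A `<=` F n)%fset ->
  cyl n A = cyl n.+1 (A :+: C n.+1)%fset.
Proof.
move=> AF; apply/seteqP; split=> x /CF_cylinderP[f [t [fA h]]]; apply/CF_cylinderP.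
  exists (f + t 0%N), (fun k => t k.+1); split; last exact: CF_coordS.
  apply/fset_addP; exists f, (t 0%N); split => //.
  by have := CF_coord_tail h 0; rewrite addn0.
move: fA h => /fset_addP[a [c [aA cC ->]]] h.
exists a, (fun k => if k is k'.+1 then t k' else c); split => //.
exact: CF_coord_unstep (fsubsetP AF _ aA) cC h.
Qed.

Lemma CF_cylinder_desc n A k : (A `<=` F n)%fset -> cyl n A = cyl (n + k) (CF_desc A n k).
Proof.
move=> AF; elim: k => [|k IH]; first by rewrite addn0.
by rewrite addnS /= -CF_cylinderS//; exact: CF_desc_sub.
Qed.

Lemma CF_cylinderI n A : cyl n A = cyl n (A `&` F n)%fset.
Proof.
apply/seteqP; split => x /CF_cylinderP[f [t [fA h]]]; apply/CF_cylinderP; exists f, t;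
  split => //.
  by rewrite in_fsetI fA (CF_coord_head h).
by move: fA; rewrite in_fsetI => /andP[].
Qed.

Lemma setI_CF_cylinder n A B : cyl n A `&` cyl n B = cyl n (A `&` B)%fset.
Proof.
apply/seteqP; split => x.
  move=> [/CF_cylinderP[f [t [fA h]]] /(CF_coord_cyl _ h) fB].
  by apply/(CF_coord_cyl _ h); rewrite in_fsetI fA.
by move=> /CF_cylinderP[f [t [/fsetIP[fA fB] h]]]; split; apply/(CF_coord_cyl _ h).
Qed.

Definition CF_cylinders : set (set X) :=
  [set U | exists n A, (A `<=` F n)%fset /\ U = cyl n A].

Lemma CF_cylinders_cyl n A : CF_cylinders (cyl n A).
Proof.
by rewrite CF_cylinderI; exists n, (A `&` F n)%fset; rewrite fsubsetIr.
Qed.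

Lemma CF_cylinders_setI : setI_closed CF_cylinders.
Proof.
move=> _ _ [n [A [AF ->]]] [m [B [BF ->]]].
rewrite (CF_cylinder_desc m AF) (CF_cylinder_desc n BF) (addnC m) setI_CF_cylinder.
exact: CF_cylinders_cyl.
Qed.

Lemma CF_cylinder_cover : \bigcup_n cyl n (F n) = setT.
Proof.
apply/seteqP; split=> // x _; have [n [f [t h]]] := CF_coord_ex x.
by exists n => //; apply/(CF_coord_cyl _ h); exact: CF_coord_head h.
Qed.

Lemma CF_head_near n (z : CF_level S n) : \forall z' \near z, CF_head z' = CF_head z.
Proof.
have c : continuous (fun w : CF_level S n => set_val w : CF_seqs G).
  exact: initial_continuous.
have : (fun w : CF_level S n => (set_val w).1 : discrete_topology G) @ z --> (set_val z).1.
  exact: (@cvg_comp _ _ _ _ fst _ _ _ (c z) cvg_fst).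
by move=> /(_ [set CF_head z]); apply; exact: discrete_set1.
Qed.

Lemma CF_tail_near n (z : CF_level S n) k :
  \forall z' \near z, CF_tail z' k = CF_tail z k.
Proof.
have c : continuous (fun w : CF_level S n => set_val w : CF_seqs G).
  exact: initial_continuous.
have : (fun w : CF_level S n => (set_val w).2 k : discrete_topology G) @ z --> (set_val z).2 k.
  have p : continuous (fun g : {ptws nat -> discrete_topology G} => g k).
    exact: (@proj_continuous nat (fun=> discrete_topology G) k).
  apply: (cvg_comp (fun w : CF_level S n => (set_val w).2) _ _ (p _)).
  exact: cvg_comp (c z) cvg_snd.
by move=> /(_ [set CF_tail z k]); apply; exact: discrete_set1.
Qed.

Lemma CF_tails_near n (z : CF_level S n) k :
  \forall z' \near z, forall i, (i < k)%N -> CF_tail z' i = CF_tail z i.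
Proof.
elim: k => [|k IH]; first by near=> w => i; rewrite ltn0.
near=> w => i; rewrite ltnS leq_eqVlt => /orP[/eqP ->|].
  by near: w; exact: CF_tail_near.
by move: i; near: w.
Unshelve. all: by end_near. Qed.

(** A set is open in the inductive limit when its trace on every level [m] is open. Points of level
    [m] near [z0] share its head and first [n] tail entries, hence its head at level [n + m], which
    decides membership in a cylinder of level [n]. *)
Lemma CF_cylinder_open n A : open (cyl n A : set (CF_space S)).
Proof.
rewrite CF_cylinderI.
have : (A `&` F n `<=` F n)%fset by exact: fsubsetIr.
move: (A `&` F n)%fset => {}A AF.
apply/sigT_openP => m; rewrite openE => z0.
rewrite /interior => /CF_cylinderP[f [t [fA h]]].
have h0 : CF_coord m (CF_head z0) (CF_tail z0) (CF_pt z0) by exists z0.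
have := CF_coord_raise m h; rewrite (addnC n) => h1.
have [ef et] := CF_coord_inj h1 (CF_coord_raise n h0).
near=> z.
have hz : CF_coord m (CF_head z) (CF_tail z) (CF_pt z) by exists z.
have zh : CF_head z = CF_head z0 by near: z; exact: CF_head_near.
have zt i : (i < n)%N -> CF_tail z i = CF_tail z0 i.
  by move: i; near: z; exact: CF_tails_near.
(* The tail [t] up to level [n + m], continued by the tail of [z]: this gives a point of the
   cylinder with the same coordinates as [z] at level [n + m]. *)
pose t' i := if (i < m)%N then t i else CF_tail z (n + (i - m)).
have [|x' h'] := @CF_coord_mk _ S n f t' (CF_coord_head h).
  move=> k; rewrite /t'; case: ltnP => km; first exact: CF_coord_tail h k.
  have := CF_coord_tail hz (n + (k - m)).
  by rewrite addnCA subnKC.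
have /(CF_coord_cyl A) /iffRL/(_ fA) := h'.
suff -> : x' = CF_pt z by [].
have := CF_coord_raise m h'; rewrite (addnC n) => h2.
apply: (CF_coord_fun h2).
have := CF_coord_raise n hz; rewrite zh.
under eq_bigr do rewrite zt//.
rewrite -ef /t'; under [in X in _ -> X]eq_bigr do rewrite ltn_ord.
set u1 := (fun _ => CF_tail _ _); set u2 := (fun _ => if _ then _ else _).
suff -> : u1 = u2 by [].
by apply/funext => i; rewrite /u1 /u2 ltnNge leq_addr /= addKn.
Unshelve. all: by end_near. Qed.

(* Otherwise points outside [O] sharing ever more coordinates with [x] would
   converge to [x]. *)
Lemma CF_cylinder_basis (O : set (CF_space S)) (x : X) n f t : open O -> O x ->
  CF_coord n f t x ->
  exists k, cyl (n + k) [fset (f + \sum_(i < k) t i)%R]%fset `<=` O.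
Proof.
move=> oO Ox h; apply: contrapT => /forallNP H.
have /choice[y hy] : forall k, exists y : CF_level S n,
    [/\ CF_head y = f, forall i, (i < k)%N -> CF_tail y i = t i & ~ O (CF_pt y)].
  move=> k; have /existsNP[x' /not_implyP[]] := H k.
  move=> /CF_cylinderP[_ [t' [/fset1P -> h']]] Ox'.
  pose t2 i := if (i < k)%N then t i else t' (i - k)%N.
  have [|x2 h2] := @CF_coord_mk _ S n f t2 (CF_coord_head h).
    move=> i; rewrite /t2; case: ltnP => ik; first exact: CF_coord_tail h i.
    have := CF_coord_tail h' (i - k).
    by rewrite -addnA subnKC.
  have x2x' : x2 = x'.
    apply: (CF_coord_fun (CF_coord_raise k h2)).
    rewrite /t2; under eq_bigr do rewrite ltn_ord.
    set u2 := (fun _ => if _ then _ else _).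
    suff -> : u2 = t' by [].
    by apply/funext => i; rewrite /u2 ltnNge leq_addr /= addKn.
  case: h2 => y [ey yh yt]; exists y; split => //.
    by move=> i ik; rewrite yt /t2 ik.
  by rewrite -ey x2x'.
case: h => y0 [x0 h0 t0].
have : y k @[k --> \oo] --> y0.
  (* The topology of a level is induced from the product, so convergence is checked on the head and
     on each tail entry. *)
  move=> U /= [_ [[B Bo <-] By0] BU].
  have c1 : (CF_head (y k) : discrete_topology G) @[k --> \oo] -->
      (CF_head y0 : discrete_topology G).
    by apply: cvg_near_cst; apply: nearW => k; have [-> _ _] := hy k.
  have c2 : ((CF_tail (y k) : {ptws nat -> discrete_topology G}) @[k --> \oo]
      --> (CF_tail y0 : {ptws nat -> discrete_topology G})).
    apply/pointwise_cvgP => i; apply: cvg_near_cst.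
    by exists i.+1 => // k /= ik; have [_ yt _] := hy k; rewrite yt// t0.
  have nB : nbhs (CF_head y0 : discrete_topology G,
      CF_tail y0 : {ptws nat -> discrete_topology G}) B.
    by rewrite -surjective_pairing; exact: (open_nbhs_nbhs (conj Bo By0)).
  have [N _ HN] := cvg_pair c1 c2 nB; exists N => // k Nk; apply: BU.
  by have := HN k Nk; rewrite /= -surjective_pairing.
move=> /(_ (fun w => O (CF_pt w))) [].
  apply: open_nbhs_nbhs; split; last by rewrite -x0.
  by move: oO => /sigT_openP /(_ n).
by move=> k _ /(_ k (leqnn k)); have [_ _] := hy k.
Qed.

End cylinders.
Arguments CF_cylinders {G} S _.

Section borel.
Context (G : zmodType) (S : CF_sequence G).
Local Notation F := (CF_F S).
Local Notation C := (CF_C S).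
Local Notation X := (CF_borel S).
Local Notation cyl := (CF_cylinder S).

(** As [F n] is finite, at each level one cylinder collects all single-head cylinders contained in
    [O], and the union over the levels is countable. *)
Lemma open_CF_cylinders (O : set (CF_space S)) : open O ->
  O = \bigcup_n cyl n [fset f in F n | `[< (cyl n [fset f]%fset `<=` O)%classic >]]%fset.
Proof.
move=> oO; apply/seteqP; split=> x.
  move=> Ox; have [n [f [t h]]] := CF_coord_ex (x : X).
  have [k hk] := CF_cylinder_basis oO Ox h; exists (n + k)%N => //.
  have h' := CF_coord_raise k h; apply/(CF_coord_cyl _ h').
  by rewrite !inE (CF_coord_head h') /=; apply/asboolP.
move=> [n _ /CF_cylinderP[f [t [+ h]]]].
by rewrite !inE => /andP[_ /asboolP]; apply; exact: CF_cylinder1 h.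
Qed.

Lemma measurable_CF_cylinder n A : measurable (cyl n A).
Proof. by apply: sub_sigma_algebra; exact: CF_cylinder_open. Qed.

(** The cylinders thus serve as generating pi-system both for the uniqueness of measures and for
    Dynkin's lemma. *)
Lemma CF_measurableE : @measurable _ X = <<s CF_cylinders S >>.
Proof.
apply/seteqP; split.
  apply: smallest_sub; first exact: smallest_sigma_algebra.
  move=> O oO; rewrite (open_CF_cylinders oO).
  have [_ _] := smallest_sigma_algebra [set: X] (CF_cylinders S); apply=> n.
  by apply: sub_sigma_algebra; exact: CF_cylinders_cyl.
apply: smallest_sub; first exact: smallest_sigma_algebra.
by move=> _ [n [A [_ ->]]]; exact: measurable_CF_cylinder.
Qed.

End borel.

(** * The action *)

Section action.
Context (G : zmodType) (S : CF_sequence G).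
Local Notation F := (CF_F S).
Local Notation C := (CF_C S).
Local Notation X := (CF_borel S).
Local Notation cyl := (CF_cylinder S).
Local Notation dom := (CF_dom S).
Local Notation T := (CF_action S).

Lemma CF_domP (x : X) :
  dom x <-> forall g, exists n f t, CF_coord n f t x /\ g + f \in F n.
Proof.
split=> H g; have := H g.
  by move=> [n [y [-> gF]]]; exists n, (CF_head y), (CF_tail y); split => //; exists y.
by move=> [n [f [t [[y [-> <- _]] gF]]]]; exists n, y.
Qed.

Lemma CF_head_raise g n f t (x : X) k : CF_coord n f t x -> g + f \in F n ->
  g + (f + \sum_(i < k) t i) \in F (n + k).
Proof.
move=> h gF; have [x' h'] := CF_coord_mk gF (CF_coord_tail h).
by rewrite addrA; exact: CF_coord_head (CF_coord_raise k h').
Qed.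

Lemma CF_dom_level (x : X) g m : dom x ->
  exists k f t, CF_coord (m + k) f t x /\ g + f \in F (m + k).
Proof.
move=> /CF_domP/(_ g)[k [f [t [h gF]]]]; exists k.
rewrite addnC; exists (f + \sum_(i < m) t i), (fun i => t (m + i)%N).
by split; [exact: CF_coord_raise|exact: CF_head_raise h gF].
Qed.

Lemma CF_dom_level2 (x : X) g g' : dom x ->
  exists n f t, [/\ CF_coord n f t x, g + f \in F n & g' + f \in F n].
Proof.
move=> /[dup] /CF_domP/(_ g)[m [f [t [h gF]]]] /(@CF_dom_level _ g' m)[k [f' [t' [h' gF']]]].
exists (m + k)%N, f', t'; split => //.
have [<- _] := CF_coord_inj (CF_coord_raise k h) h'.
exact: CF_head_raise h gF.
Qed.

(** The action chooses an image point computed at some level; raising any two levels to their sum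
    shows that the choice is unique. *)
Lemma CF_action_coord g n f t (x : X) :
  dom x -> CF_coord n f t x -> g + f \in F n -> CF_coord n (g + f) t (T g x).
Proof.
move=> xD h gF; have [x' h'] := CF_coord_mk gF (CF_coord_tail h).
set P := [set x' | dom x /\ exists n (y y' : CF_level S n),
    [/\ x = CF_pt y, x' = CF_pt y', CF_head y' = g + CF_head y &
        CF_tail y' = CF_tail y]].
have : P (T g x).
  apply: xgetPex; exists x'; split => //.
  case: h => y [xy yf yt]; case: h' => y' [xy' yf' yt'].
  by exists n, y, y'; rewrite yf yf' yt yt'.
move=> [_ [m [y [y' [xy Ty yf yt]]]]].
have hy : CF_coord m (CF_head y) (CF_tail y) x by exists y.
have hy' : CF_coord m (g + CF_head y) (CF_tail y) (T g x) by exists y'.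
have h1 := CF_coord_raise n hy; have h2 := CF_coord_raise m h.
rewrite addnC in h1; have [e1 e2] := CF_coord_inj h1 h2.
have := CF_coord_raise n hy'; rewrite addnC -addrA e1 e2 addrA.
by move=> /CF_coord_fun/(_ (CF_coord_raise m h')) ->.
Qed.

Lemma CF_action_out g (x : X) : ~ dom x -> T g x = x.
Proof. by move=> xD; apply: xgetPN => x' []. Qed.

Lemma CF_action_dom g (x : X) : dom x -> dom (T g x).
Proof.
move=> xD; apply/CF_domP => g'.
have [n [f [t [h gF gF']]]] := CF_dom_level2 g (g' + g) xD.
exists n, (g + f), t; split; first exact: CF_action_coord.
by rewrite addrA.
Qed.

Lemma CF_action0 (x : X) : T 0 x = x.
Proof.
have [xD|/CF_action_out //] := pselect (dom x).
have /CF_domP/(_ 0)[n [f [t [h gF]]]] := xD.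
have := CF_action_coord xD h gF; rewrite add0r => h'.
exact: CF_coord_fun h' h.
Qed.

Lemma CF_actionD g g' (x : X) : T (g + g') x = T g (T g' x).
Proof.
have [xD|xD] := pselect (dom x); last by rewrite !CF_action_out.
have [n [f [t [h gF gF']]]] := CF_dom_level2 g' (g + g') xD.
have h1 := CF_action_coord xD h gF; have h2 := CF_action_coord xD h gF'.
apply: (CF_coord_fun h2); rewrite -addrA.
by apply: CF_action_coord => //; [exact: CF_action_dom|rewrite addrA].
Qed.

Lemma CF_actionK g : cancel (T g) (T (- g)).
Proof. by move=> x; rewrite -CF_actionD addNr CF_action0. Qed.

Lemma CF_actionNK g : cancel (T (- g)) (T g).
Proof. by move=> x; rewrite -CF_actionD subrr CF_action0. Qed.

Lemma CF_action_image g (A : set X) : T g @` A = T (- g) @^-1` A.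
Proof.
apply/seteqP; split=> x; first by move=> [y Ay <-]; rewrite /= CF_actionK.
by move=> Ax; exists (T (- g) x) => //; rewrite CF_actionNK.
Qed.

Lemma CF_dom_preimage g (x : X) : dom (T g x) = dom x.
Proof.
apply/propext; split; last exact: CF_action_dom.
by move=> /(CF_action_dom (- g)); rewrite CF_actionK.
Qed.

(** The heads of level [n + k] that [g] moves to heads of points of $[A]_n$. For [A = F n] and
    [k = 0] these are the heads that [g] keeps inside [F n]. *)
Definition CF_shift (g : G) (A : {fset G}) n k : {fset G} :=
  [fset f in F (n + k)%N | (g + f)%R \in CF_desc S A n k]%fset.

Lemma CF_shift_sub g A n k : (CF_shift g A n k `<=` F (n + k))%fset.
Proof. by apply/fsubsetP => f; rewrite !inE => /andP[]. Qed.

(** The level from which [g] can be added to the head depends on the point, so the preimage is a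
    union over all levels from [n] on. *)
Lemma CF_preimage_cylinder g n A (x : X) : (A `<=` F n)%fset -> dom x ->
  cyl n A (T g x) <-> exists k, cyl (n + k) (CF_shift g A n k) x.
Proof.
move=> AF xD; split.
  have [k [f [t [h gF]]]] := CF_dom_level g n xD.
  have h' := CF_action_coord xD h gF.
  rewrite (CF_cylinder_desc k AF) => /(CF_coord_cyl _ h') gA.
  exists k; apply/(CF_coord_cyl _ h).
  by rewrite !inE gA andbT (CF_coord_head h).
move=> [k /CF_cylinderP[f [t [+ h]]]]; rewrite !inE => /andP[fF gA].
rewrite (CF_cylinder_desc k AF); apply/CF_cylinderP; exists (g + f), t; split => //.
apply: CF_action_coord => //.
by apply: (fsubsetP (CF_desc_sub k AF)).
Qed.

Lemma CF_domE : dom = \bigcap_g \bigcup_n cyl n (CF_shift g (F n) n 0).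
Proof.
apply/seteqP; split=> x.
  move=> /CF_domP xD g _; have [n [f [t [h gF]]]] := xD g.
  exists n => //; apply/(CF_coord_cyl _ h).
  by rewrite !inE /= addn0 gF (CF_coord_head h).
move=> H; apply/CF_domP => g; have [n _ /CF_cylinderP[f [t [+ h]]]] := H g I.
by rewrite !inE addn0 => /andP[_ gF]; exists n, f, t.
Qed.

Lemma measurable_CF_dom : countable [set: G] -> measurable dom.
Proof.
move=> cG; rewrite CF_domE -[X in measurable X]setCK setC_bigcap.
apply: measurableC; apply: countable_bigcupT_measurable => // g.
apply: measurableC; apply: bigcupT_measurable => n.
exact: measurable_CF_cylinder.
Qed.

Lemma measurable_CF_action g : countable [set: G] -> measurable_fun setT (T g).
Proof.
move=> cG; have mD := measurable_CF_dom cG.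
apply: (@measurability _ _ X X setT (T g) _ (CF_measurableE S)) =>
  _ [_ [n [A [AF ->]]] <-]; rewrite setTI.
(* Off the domain [T g] is the identity, which gives the second piece. *)
rewrite (_ : _ @^-1` _ = dom `&` (\bigcup_k cyl (n + k) (CF_shift g A n k))
                        `|` ~` dom `&` cyl n A); last first.
  apply/seteqP; split=> x.
    have [xD|xD] := pselect (dom x); last by rewrite /= CF_action_out//; right.
    by move=> /(CF_preimage_cylinder g AF xD)[k kx]; left; split => //; exists k.
  case=> -[xD]; last by rewrite /= CF_action_out.
  by move=> [k _ kx]; apply/(CF_preimage_cylinder g AF xD); exists k.
apply: measurableU; apply: measurableI => //.
- by apply: bigcupT_measurable => k; exact: measurable_CF_cylinder.
- exact: measurableC.
- exact: measurable_CF_cylinder.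
Qed.

Lemma measurable_CF_image g (A : set X) : countable [set: G] -> measurable A ->
  measurable (T g @` A).
Proof.
move=> cG mA; rewrite CF_action_image -[X in measurable X]setTI.
exact: measurable_CF_action.
Qed.

End action.

(** * The measure and its invariance *)

Section measure.
Context (G : zmodType) (S : CF_sequence G) (R : realType).
Local Notation F := (CF_F S).
Local Notation C := (CF_C S).
Local Notation X := (CF_borel S).
Local Notation cyl := (CF_cylinder S).
Local Notation dom := (CF_dom S).
Local Notation T := (CF_action S).
Context (cG : countable [set: G]) (S_full : CF_full R S).
Context (mu : {measure set X -> \bar R}) (mu_CF : is_CF_measure mu).

Local Notation N n := (\prod_(1 <= k < n.+1) #|` C k|)%N.

Lemma CF_card_gt0 n : (0 < N n)%N.
Proof.
rewrite big_add1 big_nat prodn_cond_gt0// => i _.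
exact: ltnW (CF_C_gt1 S i).
Qed.

(** Connects condition (D) with the decomposition of cylinders in [CF_cylinder_desc]. *)
Lemma fset_add_desc A n k :
  (A :+: \big[@fset_add G/[fset 0]]_(n.+1 <= i < (n + k).+1) C i = CF_desc S A n k)%fset.
Proof.
elim: k => [|k IH] /=; first by rewrite addn0 big_geq// fset_add0.
by rewrite -IH addnS big_nat_recr /= ?ltnS ?leq_addr// fset_addA.
Qed.

Lemma card_fset_translate (g : G) (A : {fset G}) :
  #|` [fset (g + f)%R | f in A]%fset| = #|` A|.
Proof. by rewrite card_imfset //; exact: addrI. Qed.

Lemma card_fset_shift (P : {fset G}) g n : (P `<=` F n)%fset ->
  #|` (P `&` CF_shift S g (F n) n 0)%fset| = #|` (([fset g] :+: P) `&` F n)%fset|.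
Proof.
move=> PF; rewrite -[LHS](card_fset_translate g).
congr (#|` _|); apply/fsetP => x; apply/imfsetP/fsetIP => /=.
  move=> [f]; rewrite !inE addn0 => /and3P[fP fF gF] ->; split => //.
  by apply/fset_addP; exists g, f; rewrite inE.
move=> [/fset_addP[_ [f [/fset1P -> fP ->]]] gF]; exists f => //.
by rewrite !inE addn0 fP gF (fsubsetP PF).
Qed.

Lemma card_CF_shift A g n k : (A `<=` F n)%fset ->
  #|` CF_shift S g A n k| =
  #|` (CF_desc S A n k `&` CF_shift S (- g) (F (n + k)) (n + k) 0)%fset|.
Proof.
move=> AF; rewrite -[LHS](card_fset_translate g).
congr (#|` _|); apply/fsetP => x; apply/imfsetP/fsetIP => /=.
  move=> [f]; rewrite !inE => /andP[fF gA] ->; split => //.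
  by rewrite addn0 addKr fF andbT (fsubsetP (CF_desc_sub k AF)).
move=> [xA]; rewrite !inE addn0 => /andP[_ gF]; exists (- g + x); rewrite ?addNKr//.
by rewrite !inE gF addNKr.
Qed.

Lemma CF_mu_cyl n A : (A `<=` F n)%fset -> mu (cyl n A) = ((#|` A|)%:R / (N n)%:R)%:E.
Proof. exact: mu_CF. Qed.

Lemma CF_mu_cyl_fin n A : (mu (cyl n A) < +oo)%E.
Proof. by rewrite CF_cylinderI CF_mu_cyl ?ltry// fsubsetIr. Qed.

Lemma CF_sigma_finite : sigma_finite setT mu.
Proof.
exists (fun n => cyl n (F n)); first by rewrite CF_cylinder_cover.
by move=> n; split; [exact: measurable_CF_cylinder|exact: CF_mu_cyl_fin].
Qed.

(** At each level [m >= n] the exceptional set lies in the part of $[F_n]_n$ whose heads [g] moves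
    out of [F m]; by (D) the measure of this part tends to 0. *)
Lemma CF_measure_out g n : (0 < n)%N ->
  mu (cyl n (F n) `\` \bigcup_m cyl m (CF_shift S g (F m) m 0)) = 0%E.
Proof.
move=> n0; set D := \bigcup_m _; set E := _ `\` _.
have mD : measurable D by apply: bigcupT_measurable => m; exact: measurable_CF_cylinder.
have mE : measurable E by apply: measurableD => //; exact: measurable_CF_cylinder.
pose a : R := #|` F n|%:R / (N n)%:R.
have Efin : (mu E < +oo)%E.
  apply: le_lt_trans (CF_mu_cyl_fin n (F n)).
  apply: le_measure; rewrite ?inE//; first exact: measurable_CF_cylinder.
  exact: subDsetl.
(* For [m >= n], [r m] is the fraction of $[F_n]_n$ on which [g] acts within level [m], so
   [a * (1 - r m)] is the measure of the rest. *)
have := S_full g n0; set r := (fun m => _) => r1.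
suff : fine (mu E) <= 0.
  move=> E0; apply/eqP; rewrite eq_le measure_ge0 andbT.
  by rewrite -[leLHS]fineK ?ge0_fin_numE ?measure_ge0// lee_fin.
have cr : a * (1 - r m) @[m --> \oo] --> a * (1 - 1).
  by apply: cvgMr; apply: cvgB => //; exact: cvg_cst.
rewrite subrr mulr0 in cr; apply: (ler_cvg_to (cvg_cst (fine (mu E))) cr).
exists n => // m /= nm; rewrite -(subnKC nm); move: (m - n)%N => k {nm m}.
have FF : (F n `<=` F n)%fset by [].
pose D0 := cyl (n + k) (CF_shift S g (F (n + k)) (n + k) 0).
have : (mu E <= mu (cyl n (F n) `\` D0))%E.
  apply: le_measure; rewrite ?inE//.
    by apply: measurableD; exact: measurable_CF_cylinder.
  by move=> x [xF xD]; split => // xD0; apply: xD; exists (n + k)%N.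
have mc m A : measurable (cyl m A) by exact: measurable_CF_cylinder.
have -> : mu (cyl n (F n) `\` D0) = (mu (cyl n (F n)) - mu (cyl n (F n) `&` D0))%E.
  exact: measureD (mc _ _) (mc _ _) (CF_mu_cyl_fin _ _).
rewrite /D0 {2}(CF_cylinder_desc k FF) setI_CF_cylinder !CF_mu_cyl//; last first.
  by apply: fsubset_trans (CF_desc_sub k FF); exact: fsubsetIl.
rewrite card_fset_shift; last by apply: CF_desc_sub.
rewrite -EFinB -[mu E]fineK ?ge0_fin_numE ?measure_ge0// lee_fin => muE.
apply: le_trans muE _.
rewrite /r /a -fset_add_desc fset_addA mulrBr mulr1 lerD2l lerN2.
set c := #|` _|; rewrite natrM.
have NE : N (n + k) = (N n * \prod_(n.+1 <= i < (n + k).+1) #|` C i|)%N.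
  by rewrite (@big_cat_nat _ _ _ n.+1)//= ltnS leq_addr.
have := CF_card_gt0 (n + k).
rewrite {1}NE muln_gt0 -!(ltr0n R) => /andP[/lt0r_neq0 N0 /lt0r_neq0 P0].
rewrite NE [in leRHS]natrM; set P := (\prod_(_ <= _ < _) _)%N in P0 *.
(* If [F n] is empty, the denominator of [r] vanishes, but so does the left-hand side; otherwise the
   two sides are equal. *)
have [->|F0] := eqVneq (#|` F n|%:R : R) 0.
  by rewrite mul0r mul0r divr_ge0// -natrM ler0n.
rewrite le_eqVlt; apply/orP; left; apply/eqP.
by field; rewrite N0 P0 F0.
Qed.

Lemma CF_mu_dom : mu (~` dom) = 0%E.
Proof.
apply: measure_negligible; first exact: (measurableC (measurable_CF_dom cG)).
(* Countability of [G] turns the union over all [g] into a union over [nat]. *)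
have [e eE] : exists e : nat -> G, forall g, exists i, e i = g.
  have /countable_injP[f f_inj] := cG.
  exists (fun i => xget 0 [set g | f g = i]) => g; exists (f g).
  apply: f_inj; rewrite ?inE//.
  by apply: (@xgetPex _ 0 [set h | f h = f g]); exists g.
have mD g m : measurable (cyl m (CF_shift S g (F m) m 0)) by exact: measurable_CF_cylinder.
(* Levels start at 1 because (D) concerns [n > 0]; a point of level [n] also has coordinates at
   level [n.+1]. *)
apply: (@negligibleS _ _ _ mu (\bigcup_i \bigcup_n
  (cyl n.+1 (F n.+1) `\` \bigcup_m cyl m (CF_shift S (e i) (F m) m 0)))).
  rewrite CF_domE setC_bigcap => x [g _ xD].
  have [i ig] := eE g.
  have [n [f [t h]]] := CF_coord_ex x; exists i => //; exists n => //; split.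
    apply/(CF_coord_cyl _ (CF_coordS h)); exact: CF_coord_head (CF_coordS h).
  by rewrite ig.
apply: negligible_bigcup => i; apply: negligible_bigcup => n.
apply/negligibleP; last exact: CF_measure_out.
by apply: measurableD; [exact: measurable_CF_cylinder|exact: bigcupT_measurable].
Qed.

Lemma CF_mu_domI A : measurable A -> mu (A `&` dom) = mu A.
Proof.
move=> mA; have mD := measurable_CF_dom cG.
have -> : mu A = (mu (A `\` dom) + mu (A `&` dom))%E by exact: measureDI.
rewrite (_ : mu (A `\` dom) = 0%E) ?add0e//.
apply: (subset_measure0 _ _ _ CF_mu_dom); [exact: measurableD|exact: measurableC|].
by move=> x [].
Qed.

Lemma CF_mu_le A B : measurable A -> measurable B ->
  (forall x, dom x -> A x -> B x) -> (mu A <= mu B)%E.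
Proof.
move=> mA mB AB; rewrite -(CF_mu_domI mA); apply: le_measure; rewrite ?inE//.
  by apply: measurableI => //; exact: measurable_CF_dom cG.
by move=> x [Ax xD]; exact: AB.
Qed.

Lemma CF_mu_eq A B : measurable A -> measurable B ->
  (forall x, dom x -> A x <-> B x) -> mu A = mu B.
Proof.
by move=> mA mB AB; apply/eqP; rewrite eq_le !CF_mu_le// => x xD; apply AB.
Qed.

(* Up to null sets both cylinders are increasing unions over [k] of cylinders of
   level [n + k], with equally many heads since [g] translates one set of heads to
   the other. *)
Lemma CF_mu_preimage_cylinder g n A : (A `<=` F n)%fset ->
  mu (T g @^-1` cyl n A) = mu (cyl n A).
Proof.
move=> AF; have mc m B : measurable (cyl m B) by exact: measurable_CF_cylinder.
pose U k := cyl (n + k) (CF_shift S g A n k).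
pose V k := cyl n A `&` cyl (n + k) (CF_shift S (- g) (F (n + k)) (n + k) 0).
have UV k : mu (U k) = mu (V k).
  rewrite /U /V (CF_cylinder_desc k AF) setI_CF_cylinder CF_mu_cyl ?CF_shift_sub//.
  rewrite CF_mu_cyl ?card_CF_shift//.
  by apply: fsubset_trans (CF_desc_sub k AF); exact: fsubsetIl.
have Und : nondecreasing_seq U.
  apply/nondecreasing_seqP => k; apply/subsetPset => x.
  move=> /CF_cylinderP[f [t [+ h]]]; rewrite !inE => /andP[fF gA].
  have := CF_coordS h; rewrite -addnS => h'; apply/(CF_coord_cyl _ h').
  rewrite !inE (CF_coord_head h') /=; apply/fset_addP; exists (g + f), (t 0%N).
  by rewrite addrA; split => //; have := CF_coord_tail h 0; rewrite addn0.
have Vnd : nondecreasing_seq V.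
  apply/nondecreasing_seqP => k; apply/subsetPset => x [xA].
  move=> /CF_cylinderP[f [t [+ h]]]; rewrite !inE addn0 => /andP[fF gF].
  have := CF_coordS h; rewrite -addnS => h'; split => //; apply/(CF_coord_cyl _ h').
  rewrite !inE addn0 (CF_coord_head h') /=.
  by have := CF_head_raise 1 h gF; rewrite big_ord1 addn1 addnS.
have mU k : measurable (U k) by exact: mc.
have mV k : measurable (V k) by exact: measurableI.
have mUU : measurable (\bigcup_k U k) by exact: bigcupT_measurable.
have mUV : measurable (\bigcup_k V k) by exact: bigcupT_measurable.
rewrite (@CF_mu_eq _ (\bigcup_k U k))//; first last.
- move=> x xD; split=> [/(CF_preimage_cylinder g AF xD)[k kx]|[k _ kx]].
    by exists k.
  by apply/(CF_preimage_cylinder g AF xD); exists k.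
- by rewrite -[X in measurable X]setTI; exact: (measurable_CF_action g cG).
rewrite [RHS](@CF_mu_eq _ (\bigcup_k V k))//; last first.
  move=> x xD; split=> [xA|[k _ []//]].
  have [k [f [t [h gF]]]] := CF_dom_level (- g) n xD; exists k => //; split => //.
  by apply/(CF_coord_cyl _ h); rewrite !inE addn0 gF (CF_coord_head h).
have cU : mu \o U @ \oo --> mu (\bigcup_k U k) by exact: nondecreasing_cvg_mu.
have cV : mu \o V @ \oo --> mu (\bigcup_k V k) by exact: nondecreasing_cvg_mu.
rewrite -(cvg_lim (@ereal_hausdorff R) cU) -(cvg_lim (@ereal_hausdorff R) cV).
by rewrite (_ : mu \o U = mu \o V)//; apply/funext => k /=; rewrite UV.
Qed.

(** The pushforward under [T g] agrees with [mu] on the cylinders, and the sets $[F_n]_n$ of finite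
    measure cover the space, so the two measures coincide. *)
Lemma CF_mu_preimage g A : measurable A -> mu (T g @^-1` A) = mu A.
Proof.
move=> mA; have mT : measurable_fun setT (T g) by exact: measurable_CF_action.
pose m2 := measure_function_pushforward__canonical__measure_function_Measure mu mT.
suff : m2 A = mu A by [].
have m2E n B : (B `<=` F n)%fset -> m2 (cyl n B) = mu (cyl n B).
  exact: CF_mu_preimage_cylinder.
apply: (@measure_unique _ R X (CF_cylinders S) (fun n => cyl n (F n))) => //.
- exact: CF_measurableE.
- exact: CF_cylinders_setI.
- by move=> n; exact: CF_cylinders_cyl.
- exact: CF_cylinder_cover.
- by move=> _ [n [B [BF ->]]]; exact: m2E.
- by move=> k; rewrite m2E// CF_mu_cyl_fin.
Qed.

Lemma CF_measure_preserving : measure_preserving_action T mu.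
Proof.
split; [exact: CF_action0|exact: CF_actionD| |exact: CF_mu_preimage].
by move=> g; exact: (measurable_CF_action g cG).
Qed.

End measure.

(** * Return sums *)

Section setwise_convergence.
Context d (T : measurableType d) (R : realType) (m : {measure set T -> \bar R}).
Context (D : set (set T)) (nu : nat -> set T -> R) (c : R).
Context (m_fin : (m setT < +oo)%E).
Context (nu_add : forall n A B, measurable A -> measurable B -> A `&` B = set0 ->
  nu n (A `|` B) = nu n A + nu n B).
Context (nu_le : \forall n \near \oo, forall A, measurable A ->
  0 <= nu n A <= fine (m A)).

Let cv A := nu n A @[n --> \oo] --> c * fine (m A).

Let fin A : measurable A -> m A \is a fin_num.
Proof.
move=> mA; rewrite ge0_fin_numE//; apply: le_lt_trans m_fin.
by apply: le_measure; rewrite ?inE.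
Qed.

Let m_add A B : measurable A -> measurable B -> A `&` B = set0 ->
  fine (m (A `|` B)) = fine (m A) + fine (m B).
Proof. by move=> mA mB AB; rewrite measureU// fineD ?fin. Qed.

Let cvU A B : measurable A -> measurable B -> A `&` B = set0 ->
  cv A -> cv B -> cv (A `|` B).
Proof.
move=> mA mB AB cA cB; rewrite /cv m_add// mulrDr.
under eq_fun do rewrite nu_add//.
exact: cvgD.
Qed.

Let cvC A : measurable A -> cv setT -> cv A -> cv (~` A).
Proof.
move=> mA cT cA; have mC := measurableC mA.
have AC : A `&` ~` A = set0 by rewrite setICr.
have e n : nu n (~` A) = nu n setT - nu n A.
  by rewrite -(setUv A) nu_add// addrAC subrr add0r.
rewrite /cv; under eq_fun do rewrite e.
have -> : fine (m (~` A)) = fine (m setT) - fine (m A).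
  by rewrite -(setUv A) m_add// addrAC subrr add0r.
by rewrite mulrBr; exact: cvgB.
Qed.

(* Domination by [m] makes the tails of a countable union small uniformly in [n]. *)
Let cv_bigcup (F : (set T)^nat) : (forall n, measurable (F n)) -> trivIset setT F ->
  (forall n, cv (F n)) -> cv set0 -> cv (\bigcup_k F k).
Proof.
move=> mF tF cF c0; pose U k := \bigcup_(i < k) F i.
have mU k : measurable (U k) by exact: bigcup_measurable.
have mUF : measurable (\bigcup_k F k) by exact: bigcupT_measurable.
have US k : U k.+1 = U k `|` F k.
  apply/seteqP; split=> x.
    move=> [i /=]; rewrite ltnS leq_eqVlt => /orP[/eqP ->|ik] Fx; first by right.
    by left; exists i.
  by move=> [[i /= ik Fx]|Fx]; [exists i => //=; exact: ltnW|exists k => /=].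
have cU k : cv (U k).
  elim: k => [|k IH].
    by rewrite /U (_ : \bigcup_(i < 0) F i = set0)//; apply/seteqP; split => // x [].
  rewrite US; apply: cvU => //; apply/seteqP; split=> // x [[i /= ik Fix] Fkx].
  by have := tF i k I I (ex_intro _ x (conj Fix Fkx)) => ik'; rewrite ik' ltnn in ik.
have mcvg : fine (m (U k)) @[k --> \oo] --> fine (m (\bigcup_k F k)).
  apply: fine_cvg; rewrite fineK ?fin//.
  have UU : \bigcup_k F k = \bigcup_k U k.
    apply/seteqP; split=> x [k _]; first by move=> Fx; exists k.+1 => //; exists k => /=.
    by move=> [i _ Fx]; exists i.
  rewrite UU; apply: nondecreasing_cvg_mu => //; first exact: bigcupT_measurable.
  by apply/nondecreasing_seqP => k; apply/subsetPset; rewrite US; exact: subsetUl.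
have Fsplit k : \bigcup_k F k = U k `|` (\bigcup_k F k `\` U k).
  by rewrite setDUK// => x [i _ Fx]; exists i.
have mD k : measurable (\bigcup_k F k `\` U k) by exact: measurableD.
have dUD k : U k `&` (\bigcup_k F k `\` U k) = set0.
  by rewrite setDE setICA setICr setI0.
apply/cvgrPdist_lt => e e0.
(* If the tail left out has measure $a$, its error is at most $(|c|+1)a$, which the bound on $a$
   chosen here keeps below $e/2$; the summand 1 keeps the denominator positive. *)
have c1 : 0 < `|c| + 1 by rewrite ltr_wpDl.
have e3 : 0 < e / (2 * (`|c| + 1)) by rewrite divr_gt0// mulr_gt0// ltr0n.
have [K KP] : exists k, fine (m (\bigcup_k F k `\` U k)) < e / (2 * (`|c| + 1)).
  have [k _ /(_ k (leqnn k))] := (@cvgrPdist_lt _ _ _ _ _ _ _).1 mcvg _ e3.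
  move=> /(le_lt_trans (ler_norm _)) kP; exists k.
  by rewrite [in X in X - _](Fsplit k) m_add// addrAC subrr add0r in kP.
have e2 : 0 < e / 2 by rewrite divr_gt0.
have near1 := (@cvgrPdist_lt _ _ _ _ _ _ _).1 (cU K) _ e2.
near=> n.
have n1 : `|c * fine (m (U K)) - nu n (U K)| < e / 2 by near: n; exact: near1.
rewrite [in X in X - _](Fsplit K) [in nu _ _](Fsplit K) nu_add// m_add//.
have /andP[b0 ba] : 0 <= nu n (\bigcup_k F k `\` U K) <= fine (m (\bigcup_k F k `\` U K)).
  by move: (mD K); move: (_ `\` _); near: n.
move: KP b0 ba; set a := fine (m (_ `\` _)); set b := nu n (_ `\` _) => KP b0 ba.
have a0 := le_trans b0 ba.
have -> : c * (fine (m (U K)) + a) - (nu n (U K) + b) =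
  (c * fine (m (U K)) - nu n (U K)) + (c * a - b) by ring.
rewrite (splitr e); apply: le_lt_trans (ler_normD _ _) _; apply: ltrD => //.
apply: le_lt_trans (ler_normB _ _) _; rewrite normrM (ger0_norm a0) (ger0_norm b0).
have : a * (`|c| + 1) < e / 2.
  rewrite -ltr_pdivlMr//; move: KP; rewrite invfM mulrA; exact.
apply: le_lt_trans; rewrite mulrDr mulr1 mulrC; exact: lerD.
Unshelve. all: by end_near. Qed.

(** The sets on which convergence holds form a Dynkin class: complements need only additivity and
    convergence on the whole space, countable disjoint unions need the domination by [m]. *)
Lemma setwise_cvg_dynkin : @measurable _ T = <<s D>> -> setI_closed D ->
  nu n setT @[n --> \oo] --> c * fine (m setT) ->
  (forall A, D A -> nu n A @[n --> \oo] --> c * fine (m A)) ->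
  forall A, measurable A -> nu n A @[n --> \oo] --> c * fine (m A).
Proof.
move=> mD DI cT cD A mA.
have c0 : cv set0 by rewrite -setCT; exact: cvC.
apply: (@dynkin_induction _ _ D cv mD DI cT cD) => //.
- by move=> B mB cB; exact: cvC.
- by move=> F mF tF cF; exact: cv_bigcup.
- by rewrite -mD.
Qed.

End setwise_convergence.

(** * Exact values of return sums over $F_n-F_n$ *)

Section return_sums.
Context (G : zmodType) (S : CF_sequence G) (R : realType).
Local Notation F := (CF_F S).
Local Notation C := (CF_C S).
Local Notation X := (CF_borel S).
Local Notation cyl := (CF_cylinder S).
Local Notation dom := (CF_dom S).
Local Notation T := (CF_action S).
Context (cG : countable [set: G]) (S_full : CF_full R S).
Context (mu : {measure set X -> \bar R}) (mu_CF : is_CF_measure mu).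

Local Notation N n := (\prod_(1 <= k < n.+1) #|` C k|)%N.
Local Notation E n := (F n :-: F n)%fset.
Local Notation Y := (cyl 0 [fset 0]%fset).
Local Notation Q n := (CF_desc S [fset 0]%fset 0 n).
Local Notation rsum := (return_sum T mu).
Let mc m B : measurable (cyl m B) := measurable_CF_cylinder m B.

Let F00 : ([fset 0] `<=` F 0)%fset. Proof. by rewrite CF_F0. Qed.
Let QF n : (Q n `<=` F n)%fset. Proof. exact: (CF_desc_sub n F00). Qed.
Let YE n : Y = cyl n (Q n). Proof. exact: (CF_cylinder_desc n F00). Qed.

Lemma CF_mu_base : mu Y = 1%E.
Proof. by rewrite mu_CF// cardfs1 big_geq// divr1. Qed.

Let N0 n : (N n)%:R != 0 :> R.
Proof. by rewrite pnatr_eq0 -lt0n; exact: CF_card_gt0. Qed.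

(** Read off from $\mu([0]_0)=1$ and $[0]_0=[Q_n]_n$ instead of being counted from (III). *)
Lemma card_CF_base n : #|` Q n|%:R = (N n)%:R :> R.
Proof.
have := CF_mu_base; rewrite (YE n) mu_CF// => -[] e.
by apply: (divIf (N0 n)); rewrite divff.
Qed.

Let fin A : A `<=` Y -> measurable A -> mu A \is a fin_num.
Proof.
move=> AY mA; rewrite ge0_fin_numE//; apply: (@le_lt_trans _ _ (mu Y)).
  by apply: le_measure; rewrite ?inE//; exact: mc.
by rewrite CF_mu_base ltry.
Qed.

(** A common element of [C n.+1] added to both terms leaves a difference unchanged. *)
Lemma CF_diff_incr n : (E n `<=` E n.+1)%fset.
Proof.
apply/fsubsetP => g /fset_subP[a [b [aF bF ->]]].
have [c cC] : exists c, c \in C n.+1.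
  by apply/fset0Pn; rewrite -cardfs_gt0; exact: ltnW (CF_C_gt1 S n).
apply/fset_subP; exists (a + c), (b + c); split.
- by apply: (fsubsetP (CF_sub S n)); apply/fset_addP; exists a, c.
- by apply: (fsubsetP (CF_sub S n)); apply/fset_addP; exists b, c.
- by rewrite opprD addrACA subrr addr0.
Qed.

Lemma CF_diff_mono n k : (E n `<=` E (n + k))%fset.
Proof.
elim: k => [|k IH]; first by rewrite addn0.
by rewrite addnS; exact: fsubset_trans IH (CF_diff_incr _).
Qed.

Lemma CF_mu_image g A B : measurable A -> measurable B ->
  mu (A `&` T g @` B) = mu (T (- g) @` A `&` B).
Proof.
move=> mA mB; rewrite -(CF_mu_preimage cG S_full mu_CF g); last first.
  by apply: measurableI => //; exact: (measurable_CF_image _ cG).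
congr (mu _); apply/seteqP; rewrite !CF_action_image opprK.
by split=> x /=; rewrite CF_actionK.
Qed.

(** The set $F_n-F_n$ is symmetric, and invariance of the measure exchanges the roles of [g] and
    [- g]. *)
Lemma return_sum_sym n A B : measurable A -> measurable B ->
  rsum (E n) A B = rsum (E n) B A.
Proof.
move=> mA mB; rewrite /return_sum.
have EE : E n = [fset - g | g in E n]%fset.
  apply/fsetP => g; apply/idP/imfsetP => /=.
    move=> /fset_subP[a [b [aF bF ->]]]; exists (b - a); last by rewrite opprB.
    by apply/fset_subP; exists b, a.
  move=> [h /fset_subP[a [b [aF bF ->]]] ->]; rewrite opprB.
  by apply/fset_subP; exists b, a.
rewrite [in RHS]EE big_imfset /=; last by move=> x y _ _ /oppr_inj.
by apply: eq_bigr => g _; rewrite CF_mu_image// setIC.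
Qed.

Lemma mu_setI_cylinder A n P : measurable A -> (mu A < +oo)%E ->
  fine (mu (A `&` cyl n P)) = \sum_(q <- enum_fset P) fine (mu (A `&` cyl n [fset q]%fset)).
Proof.
move=> mA fA; have mAc B : measurable (A `&` cyl n B) by exact: measurableI.
have fAc B : mu (A `&` cyl n B) \is a fin_num.
  rewrite ge0_fin_numE//; apply: le_lt_trans fA.
  by apply: le_measure; rewrite ?inE.
elim/fset1U_rect: P => [|q P qP IH].
  rewrite big_seq_fset0 (_ : cyl n fset0 = set0) ?setI0 ?measure0//.
  by apply/seteqP; split => // x /CF_cylinderP[f [t []]]; rewrite in_fset0.
rewrite big_fsetU1//= -IH -fineD//; congr fine.
rewrite -measureU//; last first.
  apply/seteqP; split=> // x [[_ x1] [_ x2]].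
  have : (cyl n [fset q]%fset `&` cyl n P) x by split.
  rewrite setI_CF_cylinder => /CF_cylinderP[f [t [/fsetIP[/fset1P ->]]]].
  by rewrite (negbTE qP).
congr (mu _); rewrite -setIUr; congr (_ `&` _).
apply/seteqP; split=> x.
  move=> /CF_cylinderP[f [t [/fset1UP[->|fP] h]]]; [left|right];
    apply/(CF_coord_cyl _ h) => //.
  by rewrite inE.
by case=> /CF_cylinderP[f [t [fP h]]]; apply/(CF_coord_cyl _ h); move: fP; rewrite !inE;
  move=> ->; rewrite ?orbT.
Qed.

Section sparse.
Context (n0 : nat).
Context (sparse : forall n, (n0 <= n)%N ->
  (([fset 0%R] :+: F n :+: F n :-: F n :-: F n) `&` (C n.+1 :-: C n.+1) = [fset 0%R])%fset).

(* If two points of one orbit with difference in [F_n - F_n] had distinct coordinates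
   beyond level [n], the last one would contradict sparseness at that level. *)
Lemma CF_desc_diff n k q q' h h' : (n0 <= n)%N -> q \in F n -> q' \in F n ->
  h - h' \in E n -> h \in CF_desc S [fset q]%fset n k ->
  h' \in CF_desc S [fset q']%fset n k -> q - q' = h - h'.
Proof.
move=> n0n qF q'F; elim: k h h' => [|k IH] h h' /=.
  by move=> _ /fset1P -> /fset1P ->.
move=> hE /fset_addP[a [c [aD cC eh]]] /fset_addP[a' [c' [aD' cC' eh']]].
have sub1 (p : G) : p \in F n -> ([fset p] `<=` F n)%fset.
  by move=> pF; apply/fsubsetP => ? /fset1P ->.
have aF := fsubsetP (CF_desc_sub k (sub1 _ qF)) _ aD.
have aF' := fsubsetP (CF_desc_sub k (sub1 _ q'F)) _ aD'.
have [u [v [uF vF uv]]] := fset_subP _ _ _ (fsubsetP (CF_diff_mono n k) _ hE).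
(* Here [u - v] rewrites [h - h'] with terms of level [n + k]. Thus [c - c'] lies both in $F+F-F-F$
   at this level and in the difference set of the next $C$, so it is 0. *)
have cc : c - c' = u + a' - v - a.
  have -> : u + a' - v - a = (u - v) + (a' - a) by rewrite (addrAC u) addrA.
  by rewrite -uv eh eh' opprD (addrACA a c) (addrC (a - a')) -(opprB a a') addrK.
have /fset1P : c - c' \in [fset 0%R]%fset.
  rewrite -(sparse (leq_trans n0n (leq_addr k n))); apply/fsetIP; split.
    rewrite cc; apply/fset_subP; exists (u + a' - v), a; split => //.
    apply/fset_subP; exists (u + a'), v; split => //.
    apply/fset_addP; exists u, a'; split => //.
    by apply/fset_addP; exists 0, u; rewrite inE add0r.
  by apply/fset_subP; exists c, c'.
move=> /eqP; rewrite subr_eq0 => /eqP e.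
have hh : h - h' = a - a' by rewrite eh eh' e opprD addrACA subrr addr0.
by rewrite hh; apply: IH => //; rewrite -hh.
Qed.

(** Only [g = q - q'] contributes to the sum, and the corresponding translate of $[q']_n$ contains
    [A] up to a null set. *)
Lemma return_sum_cylinder1 n q q' A : (n0 <= n)%N -> q \in Q n -> q' \in Q n ->
  measurable A -> A `<=` cyl n [fset q]%fset ->
  rsum (E n) A (cyl n [fset q']%fset) = fine (mu A).
Proof.
move=> n0n qQ q'Q mA Aq.
have [qF q'F] := (fsubsetP (QF n) _ qQ, fsubsetP (QF n) _ q'Q).
have mAT g : measurable (A `&` T g @` cyl n [fset q']%fset).
  by apply: measurableI => //; exact: (measurable_CF_image _ cG).
rewrite /return_sum (big_fsetD1 (q - q')) /=; last first.
  by apply/fset_subP; exists q, q'.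
rewrite big1_seq ?addr0.
  congr fine; apply: CF_mu_eq => // x xD; split => [[]//|Ax]; split => //.
  rewrite CF_action_image /=.
  have /CF_cylinderP[_ [t [/fset1P -> h]]] := Aq x Ax.
  have e : - (q - q') + q = q' by rewrite opprB subrK.
  have := CF_action_coord (g := - (q - q')) xD h; rewrite e => /(_ q'F).
  exact: CF_cylinder1.
move=> g /andP[_]; rewrite !inE => /andP[gq gE].
rewrite (@CF_mu_eq _ _ _ cG S_full _ mu_CF _ set0) ?measure0// => x xD; split => //.
move=> [/Aq xq]; rewrite CF_action_image /= => xq'.
(* At level [n + k] the point [x] and its image under $T_{-g}$ have heads [h] and [- g + h], whose
   difference is [g]; [CF_desc_diff] then forces [g = q - q']. *)
have [k [h [t [hx gh]]]] := CF_dom_level (- g) n xD.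
have sub1 (p : G) : p \in F n -> ([fset p] `<=` F n)%fset.
  by move=> pF; apply/fsubsetP => ? /fset1P ->.
move: xq; rewrite (CF_cylinder_desc k (sub1 _ qF)) => /(CF_coord_cyl _ hx) hq.
move: xq'; rewrite (CF_cylinder_desc k (sub1 _ q'F)).
move=> /(CF_coord_cyl _ (CF_action_coord xD hx gh)) hq'.
have hg : h - (- g + h) = g by rewrite opprD opprK addrCA subrr addr0.
move/eqP: gq; apply; rewrite -hg.
by rewrite (CF_desc_diff n0n qF q'F _ hq hq')// hg.
Qed.

(** Cutting [A] along the $[q]_n$ with [q] in [Q n] shows that each $[q']_n$ contributes $\mu(A)$.
    There are $\#P=\#C_1\cdots\#C_n\,\mu([P]_n)$ of them. *)
Lemma return_sum_cylinder n P A : (n0 <= n)%N -> (P `<=` Q n)%fset ->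
  measurable A -> A `<=` Y ->
  rsum (E n) A (cyl n P) = (N n)%:R * (fine (mu A) * fine (mu (cyl n P))).
Proof.
move=> n0n PQ mA AY.
have muoo B : measurable B -> B `<=` Y -> (mu B < +oo)%E.
  by move=> mB BY; rewrite -ge0_fin_numE ?fin.
have one q' : q' \in Q n -> rsum (E n) A (cyl n [fset q']%fset) = fine (mu A).
  move=> q'Q.
  transitivity (\sum_(q <- enum_fset (Q n))
      rsum (E n) (A `&` cyl n [fset q]%fset) (cyl n [fset q']%fset)).
    rewrite /return_sum exchange_big /=; apply: eq_bigr => g _.
    have mAT : measurable (A `&` T g @` cyl n [fset q']%fset).
      by apply: measurableI => //; exact: (measurable_CF_image _ cG).
    under eq_bigr do rewrite setIAC.
    rewrite -mu_setI_cylinder//; last by apply: muoo => // x [/AY].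
    by rewrite [in RHS]setIAC -(YE n) (setIidl AY).
  rewrite -[in RHS](setIidl AY) (YE n) mu_setI_cylinder ?muoo//.
  apply: eq_big_seq => q qQ; apply: (@return_sum_cylinder1 n q q') => //.
  exact: measurableI.
transitivity (\sum_(q <- enum_fset P) rsum (E n) A (cyl n [fset q]%fset)).
  rewrite /return_sum exchange_big /=; apply: eq_bigr => g _.
  rewrite CF_mu_image// mu_setI_cylinder//.
  - by apply: eq_bigr => q _; rewrite CF_mu_image.
  - exact: (measurable_CF_image _ cG).
  - by rewrite CF_action_image opprK CF_mu_preimage// muoo.
rewrite (@eq_big_seq _ _ _ _ _ _ (fun=> fine (mu A))); last first.
  by move=> q qP; rewrite one// (fsubsetP PQ).
rewrite mu_CF; last exact: fsubset_trans PQ (QF n).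
rewrite big_const_seq count_predT iter_addr addr0 -[LHS]mulr_natr.
rewrite [RHS]mulrCA; congr (_ * _).
by rewrite /= mulrCA divff// mulr1.
Qed.

End sparse.
End return_sums.

(** * Limit of the normalized sums, conservativity and ergodicity *)

Section limit.
Context (G : zmodType) (S : CF_sequence G) (R : realType).
Local Notation F := (CF_F S).
Local Notation C := (CF_C S).
Local Notation X := (CF_borel S).
Local Notation cyl := (CF_cylinder S).
Local Notation dom := (CF_dom S).
Local Notation T := (CF_action S).
Local Notation N n := (\prod_(1 <= k < n.+1) #|` C k|)%N.
Local Notation E n := (F n :-: F n)%fset.
Local Notation Y := (cyl 0 [fset 0]%fset).
Local Notation Q n := (CF_desc S [fset 0]%fset 0 n).
Context (cG : countable [set: G]) (S_full : CF_full R S).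
Context (mu : {measure set X -> \bar R}) (mu_CF : is_CF_measure mu).
Local Notation rsum := (return_sum T mu).
Context (sparse : \forall n \near \oo,
  (([fset 0%R] :+: F n :+: F n :-: F n :-: F n) `&` (C n.+1 :-: C n.+1) = [fset 0%R])%fset).

Let mc m B : measurable (cyl m B) := measurable_CF_cylinder m B.

Let fin A : A `<=` Y -> measurable A -> mu A \is a fin_num.
Proof.
move=> AY mA; rewrite ge0_fin_numE//; apply: (@le_lt_trans _ _ (mu Y)).
  by apply: le_measure; rewrite ?inE.
by rewrite CF_mu_base// ltry.
Qed.

Let fine_pos A : A `<=` Y -> measurable A -> (0 < mu A)%E -> 0 < fine (mu A).
Proof.
by move=> AY mA A0; apply: fine_gt0; rewrite A0 -ge0_fin_numE ?fin.
Qed.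

Let N0 n : (N n)%:R != 0 :> R.
Proof. by rewrite pnatr_eq0 -lt0n; exact: CF_card_gt0. Qed.

Let F00 : ([fset 0] `<=` F 0)%fset. Proof. by rewrite CF_F0. Qed.

Let YE n : Y = cyl n (Q n). Proof. exact: (CF_cylinder_desc n F00). Qed.

Let mAT g A B : measurable A -> measurable B -> measurable (A `&` T g @` B).
Proof. by move=> mA mB; apply: measurableI => //; exact: (measurable_CF_image _ cG). Qed.

(** The threshold for [n] does not depend on [A]; this uniformity gives the domination in
    [return_ratio_cvg]. *)
Lemma return_sum_base : \forall n \near \oo, forall A, measurable A -> A `<=` Y ->
  rsum (E n) A Y = (N n)%:R * fine (mu A).
Proof.
have [n0 _ sp] := sparse; exists n0 => // n /= n0n A mA AY.
rewrite {1}(YE n) (return_sum_cylinder cG S_full mu_CF sp)// -YE.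
by rewrite (CF_mu_base mu_CF) mulr1.
Qed.

Let return_sum_add n A B B' : A `<=` Y -> measurable A -> measurable B ->
  measurable B' -> B `&` B' = set0 ->
  rsum (E n) A (B `|` B') = rsum (E n) A B + rsum (E n) A B'.
Proof.
move=> AY mA mB mB' BB'; rewrite /return_sum -big_split /=; apply: eq_bigr => g _.
have fAT B1 : measurable B1 -> mu (A `&` T g @` B1) \is a fin_num.
  by move=> mB1; apply: fin; [move=> x [/AY]|exact: mAT].
rewrite -fineD ?fAT// image_setU setIUr measureU//; [exact: mAT..|].
apply/seteqP; split => // x [[_ xB] [_ xB']].
move: xB xB'; rewrite !CF_action_image /= => xB xB'.
by rewrite -[False]/(set0 (T (- g) x)) -BB'.
Qed.

Let return_sum_ge0 n A B : 0 <= rsum (E n) A B.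
Proof. by apply: sumr_ge0 => g _; exact: fine_ge0. Qed.

Let return_sum_le n A B B' : measurable A -> measurable B -> measurable B' ->
  A `<=` Y -> B `<=` B' -> rsum (E n) A B <= rsum (E n) A B'.
Proof.
move=> mA mB mB' AY BB'; apply: ler_sum => g _.
have fAT B1 : measurable B1 -> mu (A `&` T g @` B1) \is a fin_num.
  by move=> mB1; apply: fin; [move=> x [/AY]|exact: mAT].
apply: fine_le; rewrite ?fAT//; apply: le_measure; rewrite ?inE; [exact: mAT..|].
by apply: setIS; exact: image_subset.
Qed.

(** For fixed [A] the normalized sums are additive in [B] and eventually constant on cylinders, so
    [setwise_cvg_dynkin] applies, with [mu] restricted to $[0]_0$ as dominating measure. *)
Lemma return_ratio_cvg A B : measurable A -> measurable B -> A `<=` Y -> B `<=` Y ->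
  rsum (E n) A B / (N n)%:R @[n --> \oo] --> fine (mu A) * fine (mu B).
Proof.
move=> mA mB AY BY.
pose m : {measure set X -> \bar R} := mrestr mu (mc 0 [fset 0]%fset).
have mE B' : m B' = mu (B' `&` Y) by [].
pose nu n B := rsum (E n) A (B `&` Y) / (N n)%:R.
have mBY D : measurable D -> measurable (D `&` Y) by move=> mD; exact: measurableI.
suff : nu n B @[n --> \oo] --> fine (mu A) * fine (m B).
  by rewrite /nu mE (setIidl BY).
apply: (@setwise_cvg_dynkin _ _ _ m (CF_cylinders S)) => //.
- by rewrite mE setTI CF_mu_base// ltry.
- move=> n D D' mD mD' DD'; rewrite /nu -mulrDl setIUl return_sum_add//; try exact: mBY.
  by rewrite setIACA DD' set0I.
(* Domination: by symmetry [A] may be moved to the second argument, where enlarging it to $[0]_0$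
   gives the exact value of [return_sum_base]. *)
- near=> n => D mD; rewrite /nu divr_ge0//=.
  rewrite ler_pdivrMr ?ltr0n ?CF_card_gt0// [leRHS]mulrC mE.
  rewrite (return_sum_sym cG S_full mu_CF)//; last exact: mBY.
  have <- : rsum (E n) (D `&` Y) Y = (N n)%:R * fine (mu (D `&` Y)).
    by move: (mBY _ mD) (@subIsetr _ D Y); move: (D `&` Y); near: n; exact: return_sum_base.
  by apply: return_sum_le => //; exact: mBY.
- exact: CF_measurableE.
- exact: CF_cylinders_setI.
- apply: cvg_near_cst; near=> n; rewrite /nu mE !setTI.
  rewrite (CF_mu_base mu_CF) mulr1 mulrC.
  have -> : rsum (E n) A Y = (N n)%:R * fine (mu A).
    by move: A mA AY {nu}; near: n; exact: return_sum_base.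
  by rewrite mulKf.
- move=> _ [k [P [PF ->]]]; apply: cvg_near_cst.
  have [n0 _ sp] := sparse; near=> n; rewrite /nu mE.
  have n0n : (n0 <= n)%N by near: n; exact: nbhs_infty_ge.
  have kn : (k <= n)%N by near: n; exact: nbhs_infty_ge.
  have -> : cyl k P `&` Y = cyl n (CF_desc S P k (n - k) `&` Q n)%fset.
    by rewrite (YE n) (CF_cylinder_desc (n - k) PF) (subnKC kn) setI_CF_cylinder.
  rewrite (return_sum_cylinder cG S_full mu_CF sp) ?fsubsetIr//.
  by rewrite mulrC mulKf.
Unshelve. all: by end_near. Qed.

(** Each factor is at least 2. Linear growth suffices to compare the normalized sums with
    [harmonic]. *)
Lemma CF_card_gtn n : (n < N n)%N.
Proof.
elim: n => [|n IH]; first by rewrite big_geq.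
rewrite big_nat_recr //=; have := CF_C_gt1 S n; move: IH.
by move: (N n) #|` _| => a b; nia.
Qed.

Lemma CF_mu_move g (A : set X) : measurable A -> mu (T g @` A) = mu A.
Proof. by move=> mA; rewrite CF_action_image CF_mu_preimage. Qed.

(** Translation by [f0 - f] with [f0] in [Q n] carries $[f]_n$ into $[0]_0$ almost everywhere. So if
    all translates of [A] met $[0]_0$ in null sets, every $A\cap[f]_n$ would be null, and hence
    [A]. *)
Lemma CF_translate_base (A : set X) : measurable A -> (0 < mu A)%E ->
  exists g, (0 < mu (T g @` A `&` Y))%E.
Proof.
move=> mA A0; apply: contrapT => /forallNP H; move: A0; apply/negP; rewrite -leNgt.
have mTA g : measurable (T g @` A `&` Y) by rewrite setIC; exact: mAT.
have null g : mu (T g @` A `&` Y) = 0%E.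
  by apply/eqP; rewrite -measure_le0 leNgt; apply/negP; exact: H.
suff An n : mu (A `&` cyl n (F n)) = 0%E.
  have -> : A = \bigcup_n (A `&` cyl n (F n)) by rewrite -setI_bigcupr CF_cylinder_cover setIT.
  rewrite le_eqVlt; apply/orP; left; apply/eqP; apply: measure_negligible.
    by apply: bigcupT_measurable => n; exact: measurableI.
  by apply: negligible_bigcup => n; apply/negligibleP; [exact: measurableI|exact: An].
have mAn : measurable (A `&` cyl n (F n)) by exact: measurableI.
have fAn : (mu (A `&` cyl n (F n)) < +oo)%E.
  apply: le_lt_trans (CF_mu_cyl_fin mu_CF n (F n)).
  by apply: le_measure; rewrite ?inE.
have fn : mu (A `&` cyl n (F n)) \is a fin_num by rewrite ge0_fin_numE.
rewrite -(fineK fn); congr EFin.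
(* One copy of $[F_n]_n$ stays with [A], so that the set cut into pieces has finite measure as
   [mu_setI_cylinder] requires. *)
rewrite -[X in mu X](setIid _) setIACA setIid setIA.
rewrite mu_setI_cylinder// big1_seq// => f /andP[_ fF].
have [f0 f0Q] : exists f0, f0 \in Q n.
  apply/fset0Pn; rewrite -cardfs_gt0 -(ltr0n R) (card_CF_base mu_CF) ltr0n.
  exact: CF_card_gt0.
have f0F : f0 \in F n := fsubsetP (CF_desc_sub n F00) _ f0Q.
have mB : measurable (A `&` cyl n (F n) `&` cyl n [fset f]%fset) by exact: measurableI.
suff : (mu (A `&` cyl n (F n) `&` cyl n [fset f]%fset) <= mu (T (f0 - f) @` A `&` Y))%E.
  by rewrite null measure_le0 => /eqP ->.
rewrite -(CF_mu_move (f0 - f) mB).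
apply: (CF_mu_le cG S_full mu_CF); [exact: (measurable_CF_image _ cG)|exact: mTA|].
move=> x xD; rewrite !CF_action_image => -[[Ax _] xf]; split => //.
have yD : dom (T (- (f0 - f)) x) by rewrite CF_dom_preimage.
move: xf => /CF_cylinderP[_ [t [/fset1P -> h]]].
have := CF_action_coord (g := f0 - f) yD h; rewrite subrK CF_actionNK => /(_ f0F) hx.
by rewrite (YE n); apply/(CF_coord_cyl _ hx).
Qed.

(** A wandering set of positive measure has a translate whose part [B] in $[0]_0$ has positive
    measure. Only [g = 0] contributes to the return sums of [B], so the normalized sums tend to 0
    and not to $\mu(B)^2>0$. *)
Lemma CF_conservative : conservative_action T mu.
Proof.
move=> A mA A0; apply: contrapT => /forallNP H.
have null g : g <> 0 -> mu (A `&` T g @` A) = 0%E.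
  move=> g0; apply/eqP; rewrite -measure_le0 leNgt; apply/negP => Ag.
  by apply: (H g).
have [h hA] := CF_translate_base mA A0; pose B := T h @` A `&` Y.
have mB : measurable B by rewrite /B setIC; exact: mAT.
have BY : B `<=` Y by exact: subIsetr.
have b0 : 0 < fine (mu B) by exact: fine_pos.
have Bg g : g <> 0 -> mu (B `&` T g @` B) = 0%E.
  (* Since [G] is commutative, $T_hA\cap T_gT_hA=T_h(A\cap T_gA)$. *)
  move=> g0; suff : (mu (B `&` T g @` B) <= mu (T h @` (A `&` T g @` A)))%E.
    by rewrite CF_mu_move ?null// ?measure_le0 => [/eqP|]//; exact: mAT.
  apply: le_measure; rewrite ?inE; [exact: mAT| |].
    by apply: (measurable_CF_image _ cG); exact: mAT.
  move=> x [[xA _]]; rewrite !CF_action_image /= => -[+ _].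
  rewrite !CF_action_image -CF_actionD addrC CF_actionD => xA'.
  by move: xA; rewrite CF_action_image /= => xA; split => //; rewrite CF_action_image.
have E0 n : 0 \in E n.
  have [q qQ] : exists q, q \in Q n.
    apply/fset0Pn; rewrite -cardfs_gt0 -(ltr0n R) (card_CF_base mu_CF) ltr0n.
    exact: CF_card_gt0.
  have qF := fsubsetP (CF_desc_sub n F00) _ qQ.
  by apply/fset_subP; exists q, q; rewrite subrr.
have rB n : rsum (E n) B B = fine (mu B).
  rewrite /return_sum (big_fsetD1 0)//= big1_seq ?addr0.
    congr (fine (mu _)); rewrite CF_action_image oppr0; apply/seteqP.
    by split=> x; rewrite /= CF_action0; [case|].
  by move=> g /andP[_]; rewrite !inE => /andP[/eqP g0 _]; rewrite Bg.
have cB := return_ratio_cvg mB mB BY BY.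
have ch : fine (mu B) * harmonic n @[n --> \oo] --> fine (mu B) * 0.
  by apply: cvgMr; exact: cvg_harmonic.
have : fine (mu B) * fine (mu B) <= fine (mu B) * 0.
  apply: (ler_cvg_to cB ch); apply: nearW => n; rewrite rB ler_pM2l//=.
  by rewrite lef_pV2 ?posrE ?ltr0n ?CF_card_gt0// ler_nat CF_card_gtn.
by rewrite mulr0 leNgt mulr_gt0.
Qed.

(** Some $T_hA$ meets $[0]_0$ in positive measure, and it differs from [A] by a null set only. *)
Let invariant_base (A : set X) : measurable A -> (forall g, mu (A `+` T g @` A) = 0%E) ->
  (0 < mu A)%E -> (0 < mu (A `&` Y))%E.
Proof.
move=> mA iA /(CF_translate_base mA)[h]; apply: contraTT; rewrite -!leNgt => AY.
have mTA : measurable (T h @` A) by exact: (measurable_CF_image _ cG).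
have mY : measurable (A `+` T h @` A) by apply: measurableU; exact: measurableD.
apply: (@le_trans _ _ (mu (A `&` Y `|` (A `+` T h @` A)))).
  apply: le_measure; rewrite ?inE; [exact: measurableI| |].
    by apply: measurableU => //; exact: measurableI.
  by move=> x [hx xY]; have [xA|xA] := pselect (A x); [left|right; right].
apply: le_trans (measureU2 _ _ _) _ => //; first exact: measurableI.
by rewrite [X in (_ + X)%E](_ : _ = 0%E) ?adde0//; exact: iA.
Qed.

(** If [A] and its complement both had positive measure, then so would their parts in $[0]_0$. By
    invariance all return sums between these parts vanish, although the limit is the product of
    their measures. *)
Lemma CF_ergodic : ergodic_action T mu.
Proof.
move=> A mA iA.
have [->|A0] := eqVneq (mu A) 0%E; [by left|right].
apply/eqP; apply/negPn/negP => C0.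
have mC : measurable (~` A) by exact: measurableC.
have TC g : T g @` (~` A) = ~` (T g @` A) by rewrite !CF_action_image.
have iC g : mu (~` A `+` T g @` (~` A)) = 0%E.
  rewrite TC -(iA g); congr (mu _).
  by apply/seteqP; split => x /= -[[a b]|[a b]]; [right|left|right|left]; split => //;
    apply: contrapT.
have pos B : mu B != 0%E -> (0 < mu B)%E by rewrite lt0e measure_ge0 andbT.
have AY0 := invariant_base mA iA (pos _ A0).
have CY0 := invariant_base mC iC (pos _ C0).
have mAY : measurable (A `&` Y) by exact: measurableI.
have mCY : measurable (~` A `&` Y) by exact: measurableI.
have sAY : A `&` Y `<=` Y by exact: subIsetr.
have sCY : ~` A `&` Y `<=` Y by exact: subIsetr.
have := return_ratio_cvg mAY mCY sAY sCY.
have r0 n : rsum (E n) (A `&` Y) (~` A `&` Y) / (N n)%:R = 0.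
  rewrite /return_sum big1 ?mul0r// => g _.
  suff -> : mu (A `&` Y `&` T g @` (~` A `&` Y)) = 0%E by [].
  apply/eqP; rewrite -measure_le0 -(iA g); apply: le_measure; rewrite ?inE.
  - exact: mAT.
  - by apply: measurableU; apply: measurableD => //; exact: (measurable_CF_image _ cG).
  (* Such a point lies in [A] but not in $T_gA$, hence in the symmetric difference. *)
  move=> x [[xA _]]; rewrite CF_action_image /= => -[xC _]; left; split => //.
  by move=> [y Ay yx]; apply: xC; rewrite -yx CF_actionK.
under eq_fun do rewrite r0.
move=> /(cvg_unique (@norm_hausdorff _ _)) /(_ (cvg_cst 0)) /eqP.
by rewrite mulf_eq0 => /orP[]; apply/negP; rewrite gt_eqF// fine_pos.
Qed.

End limit.

(** * Weak rational ergodicity along $F_n-F_n$ *)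

Theorem theorem2p8 (R : realType) (G : zmodType)
    (G_countable : countable [set: G]) (G_infinite : infinite_set [set: G])
    (S : CF_sequence G) (S_full : CF_full R S)
    (mu : {measure set (CF_borel S) -> \bar R}) (mu_CF : is_CF_measure mu)
    (S_sparse : forall g : G, \forall n \near \oo,
      (([fset g] :+: CF_F S n :+: CF_F S n :-: CF_F S n :-: CF_F S n)
         `&` (CF_C S n.+1 :-: CF_C S n.+1) = [fset 0%R])%fset) :
  (forall A B : set (CF_borel S), measurable A -> measurable B ->
     A `<=` CF_cylinder S 0 [fset 0]%fset ->
     B `<=` CF_cylinder S 0 [fset 0]%fset ->
     (fun n =>
        let E := (CF_F S n :-: CF_F S n)%fset in
        let Y0 := CF_cylinder S 0 [fset 0]%fset in
        return_sum (CF_action S) mu E A B /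
        return_sum (CF_action S) mu E Y0 Y0)
     @ \oo --> fine (mu A) * fine (mu B)) /\
  weakly_rationally_ergodic (CF_action S) mu
    (fun n => (CF_F S n :-: CF_F S n)%fset).
Proof.
have sp := S_sparse 0.
have base := return_sum_base G_countable S_full mu_CF sp.
set Y0 := CF_cylinder S 0 [fset 0]%fset.
have mY : measurable Y0 by exact: measurable_CF_cylinder.
have rYY : \forall n \near \oo,
    return_sum (CF_action S) mu (CF_F S n :-: CF_F S n)%fset Y0 Y0 =
    (\prod_(1 <= k < n.+1) #|` CF_C S k|)%N%:R.
  near=> n; have -> : (\prod_(1 <= k < n.+1) #|` CF_C S k|)%N%:R =
    (\prod_(1 <= k < n.+1) #|` CF_C S k|)%N%:R * fine (mu Y0).
    by rewrite (CF_mu_base mu_CF) mulr1.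
  by move: mY (@subset_refl _ Y0); near: n; apply: filterS base => n bn; exact: bn.
have ratio A B : measurable A -> measurable B -> A `<=` Y0 -> B `<=` Y0 ->
    return_sum (CF_action S) mu (CF_F S n :-: CF_F S n)%fset A B /
    return_sum (CF_action S) mu (CF_F S n :-: CF_F S n)%fset Y0 Y0
    @[n --> \oo] --> fine (mu A) * fine (mu B).
  move=> mA mB AY BY.
  (* The return sum of $[0]_0$ with itself is eventually $\#C_1\cdots\#C_n$, so it may replace that
     product as normalization. *)
  apply: cvg_trans (return_ratio_cvg G_countable S_full mu_CF sp mA mB AY BY).
  by apply: near_eq_cvg; near=> n; congr (_ / _); apply/esym; near: n; exact: rYY.
split; first by move=> A B mA mB AY BY; exact: ratio.
split.
- exact: CF_sigma_finite.
- split; first exact: CF_measure_preserving.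
  exact: (CF_conservative G_countable S_full mu_CF sp).
- exact: (CF_ergodic G_countable S_full mu_CF sp).
- exact: CF_diff_incr.
(* Since $[0]_0$ has measure 1, dividing by the square of its measure changes nothing, and [ratio]
   is the required limit. *)
- exists Y0; rewrite /= (CF_mu_base mu_CF) lte01 ltry; split => // A B mA mB AY BY.
  have := ratio A B mA mB AY BY.
  by under eq_fun do rewrite mulrC -[X in X^-1 * _]divr1 -[X in _ / X](expr1n _ 2).
Unshelve. all: by end_near. Qed.
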